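(* There exists a family of mixed substitution systems $(F,s)$ whose tiling spaces $\Omega_{F,s}$ are all minimal (under the translation action of $\mathbb{R}$) and such that the collection of isomorphism classes of the first Čech cohomology groups $\check{H}^1(\Omega_{F,s})$, as $(F,s)$ ranges over the family, is uncountable.
   Context: Let $\mathcal{A}$ be a finite alphabet, and let $\mathcal{A}^*=\bigcup_{n\ge 1}\mathcal{A}^n$ be the set of non-empty finite words. A substitution is a map $\phi\colon\mathcal{A}\to\mathcal{A}^*$, extended to words by concatenation. A mixed substitution system is a pair $(F,s)$, where $F=\{\phi_0,\dots,\phi_k\}$ is a finite set of substitutions on $\mathcal{A}$ and $s=(s_0,s_1,s_2,\dots)\in\{0,\dots,k\}^{\mathbb{N}}$. For $m\le n$ write $\phi_{s[m,n]}=\phi_{s_m}\circ\phi_{s_{m+1}}\circ\cdots\circ\phi_{s_n}$. A bi-infinite sequence $\mathcal{T}=(a_j)_{j\in\mathbb{Z}}\in\mathcal{A}^{\mathbb{Z}}$ is admitted by $(F,s)$ if every finite string $a_t a_{t+1}\cdots a_{t+u}$ ($t\in\mathbb{Z}$, $u\ge 0$) is a subword of $\phi_{s[0,n]}(a)$ for some $n\ge 0$ and some $a\in\mathcal{A}$. The discrete hull $\Sigma_{F,s}\subset\mathcal{A}^{\mathbb{Z}}$ is the set of all admitted sequences (with the subspace topology from the product topology). It is invariant under the left shift $\sigma$. The tiling space is the suspension $\Omega_{F,s}=(\Sigma_{F,s}\times[0,1])/{\sim}$, where $(\mathcal{T},1)\sim(\sigma(\mathcal{T}),0)$. The translation action of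 $\mathbb{R}$ on $\Omega_{F,s}$ is $r\cdot(\mathcal{T},t)=(\sigma^{\lfloor t+r\rfloor}(\mathcal{T}),\,t+r-\lfloor t+r\rfloor)$ for $t\in[0,1)$, $r\in\mathbb{R}$. The tiling space is minimal if every orbit of this action is dense. Cohomology has integer coefficients. *)

(* Defs.v *)
From HB Require Import structures.
From mathcomp Require Import all_boot all_order all_algebra.
From mathcomp Require Import all_classical all_reals topology num_topology.
From mathcomp Require Import subtype_topology quotient_topology function_spaces.
From mathcomp Require Import discrete_topology.
From mathcomp Require Import zify.

Set Implicit Arguments.
Unset Strict Implicit.
Unset Printing Implicit Defensive.
Import Order.TTheory GRing.Theory Num.Theory.
Import numFieldTopology.Exports.
Local Open Scope classical_set_scope.
Local Open Scope ring_scope.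
Local Open Scope quotient_scope.

(** * First Cech cohomology with integer coefficients *)

Section Cech.
Variable X : topologicalType.
Implicit Types (U V W : set (set X)) (A B C : set X) (r s : set X -> set X).

Definition open_cover U : Prop :=
  U `<=` open /\ \bigcup_(A in U) A = [set: X].

(** Integral ordered cochains of the nerve of [U].  A simplex of the nerve is
    a tuple of members of [U] with nonempty common intersection; cochains are
    total functions whose values off the nerve are irrelevant. *)
Definition is_cocycle1 U (f : set X -> set X -> int) : Prop :=
  forall A B C, U A -> U B -> U C -> A `&` B `&` C !=set0 ->
    f B C - f A C + f A B = 0.

Definition is_coboundary1 U (f : set X -> set X -> int) : Prop :=
  exists h : set X -> int,
    forall A B, U A -> U B -> A `&` B !=set0 -> f A B = h B - h A.

Definition refinement_map V U r : Prop :=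
  forall A, V A -> U (r A) /\ A `<=` r A.

Record cech_cocycle := CechCocycle {
  cc_cover : set (set X);
  cc_fun :> set X -> set X -> int;
  cc_open_cover : open_cover cc_cover;
  cc_is_cocycle : is_cocycle1 cc_cover cc_fun }.

HB.instance Definition _ := gen_eqMixin cech_cocycle.
HB.instance Definition _ := gen_choiceMixin cech_cocycle.

(** Equality in the direct limit, over open covers ordered by refinement, of
    the first cohomology groups of the nerves. *)
Definition cech_equiv (f g : cech_cocycle) : Prop :=
  exists W r s, [/\ open_cover W,
    refinement_map W (cc_cover f) r,
    refinement_map W (cc_cover g) s &
    is_coboundary1 W (fun A B => f (r A) (r B) - g (s A) (s B))].

Definition cover_meet U V : set (set X) :=
  [set A `&` B | A in U & B in V].

Definition refine U : set X -> set X :=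
  fun A => xget set0 [set B | U B /\ A `<=` B].

Lemma open_cover_meet U V :
  open_cover U -> open_cover V -> open_cover (cover_meet U V).
Proof.
move=> [oU cU] [oV cV]; split.
  by move=> _ [A UA [B VB <-]]; apply: openI; [exact: oU|exact: oV].
rewrite -subTset => x _.
have [A UA Ax] : (\bigcup_(A in U) A) x by rewrite cU.
have [B VB Bx] : (\bigcup_(A in V) A) x by rewrite cV.
by exists (A `&` B) => //; exists A => //; exists B.
Qed.

Lemma refineP U V :
  (forall A, V A -> exists2 B, U B & A `<=` B) -> refinement_map V U (refine U).
Proof.
move=> VU A /VU [B UB AB]; rewrite /refine.
by apply: (@xgetPex _ _ [set B | U B /\ A `<=` B]); exists B.
Qed.

Lemma refine_meetl U V : refinement_map (cover_meet U V) U (refine U).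
Proof. by apply: refineP => _ [A UA [B _ <-]]; exists A => // ? []. Qed.

Lemma refine_meetr U V : refinement_map (cover_meet U V) V (refine V).
Proof. by apply: refineP => _ [A _ [B VB <-]]; exists B => // ? []. Qed.

Lemma refinement_comp U V W r s :
  refinement_map V U r -> refinement_map W V s ->
  refinement_map W U (r \o s).
Proof.
move=> rP sP A /sP[VA As]; have [UA sr] := rP _ VA.
by split => //; apply: subset_trans sr.
Qed.

Lemma refinement_id U : refinement_map U U id.
Proof. by move=> A UA; split. Qed.

Lemma pullback_cocycle U W r f : refinement_map W U r ->
  is_cocycle1 U f -> is_cocycle1 W (fun A B => f (r A) (r B)).
Proof.
move=> rP fP A B C /rP[UA rA] /rP[UB rB] /rP[UC rC] [x [[Ax Bx] Cx]].
by apply: fP => //; exists x; split; [split; [exact: rA|exact: rB]|exact: rC].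
Qed.

Lemma add_cocycle U f g : is_cocycle1 U f -> is_cocycle1 U g ->
  is_cocycle1 U (fun A B => f A B + g A B).
Proof.
move=> fP gP A B C UA UB UC ABC.
have := fP A B C UA UB UC ABC; have := gP A B C UA UB UC ABC.
by lia.
Qed.

Lemma opp_cocycle U f : is_cocycle1 U f -> is_cocycle1 U (fun A B => - f A B).
Proof. by move=> fP A B C UA UB UC ABC; rewrite -!opprD fP ?oppr0. Qed.

Lemma open_cover1 : open_cover [set setT].
Proof.
by split; [move=> _ ->; exact: openT|rewrite bigcup_set1].
Qed.

Lemma zero_cocycle U : is_cocycle1 U (fun _ _ => 0).
Proof. by move=> A B C *; rewrite subr0 addr0. Qed.

Lemma pullback_indep U W r s f : refinement_map W U r -> refinement_map W U s ->
  is_cocycle1 U f ->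
  is_coboundary1 W (fun A B => f (r A) (r B) - f (s A) (s B)).
Proof.
move=> rP sP fP; exists (fun A => - f (r A) (s A)) => A B WA WB [x [Ax Bx]].
have [UrA rA] := rP _ WA; have [UsA sA] := sP _ WA.
have [UrB rB] := rP _ WB; have [UsB sB] := sP _ WB.
have e1 : f (r B) (s B) - f (r A) (s B) + f (r A) (r B) = 0.
  by apply: fP => //; exists x; do ![split]; [exact: rA|exact: rB|exact: sB].
have e2 : f (s A) (s B) - f (r A) (s B) + f (r A) (s A) = 0.
  by apply: fP => //; exists x; do ![split]; [exact: rA|exact: sA|exact: sB].
by lia.
Qed.

Lemma coboundaryD U f g : is_coboundary1 U f -> is_coboundary1 U g ->
  is_coboundary1 U (fun A B => f A B + g A B).
Proof.
move=> [h hP] [k kP]; exists (fun A => h A + k A) => A B UA UB AB.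
by rewrite hP// kP// opprD addrACA.
Qed.

Lemma coboundaryN U f : is_coboundary1 U f ->
  is_coboundary1 U (fun A B => - f A B).
Proof.
move=> [h hP]; exists (fun A => - h A) => A B UA UB AB.
by rewrite hP// opprB opprK addrC.
Qed.

Lemma coboundary_pullback U W r f : refinement_map W U r ->
  is_coboundary1 U f -> is_coboundary1 W (fun A B => f (r A) (r B)).
Proof.
move=> rP [h hP]; exists (h \o r) => A B /rP[UA rA] /rP[UB rB] [x [Ax Bx]] /=.
by apply: hP => //; exists x; split; [exact: rA|exact: rB].
Qed.

Lemma coboundary_ext U f g : (forall A B, f A B = g A B) ->
  is_coboundary1 U f -> is_coboundary1 U g.
Proof. by move=> fg [h hP]; exists h => A B *; rewrite -fg hP. Qed.

Lemma coboundary0 U : is_coboundary1 U (fun _ _ => 0).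
Proof. by exists (fun=> 0) => A B *; rewrite subrr. Qed.

Lemma cech_equiv_refl f : cech_equiv f f.
Proof.
exists (cc_cover f), id, id; split;
  [exact: cc_open_cover|exact: refinement_id|exact: refinement_id|].
by apply: (coboundary_ext _ ((coboundary0 _))) => A B; rewrite subrr.
Qed.

Lemma cech_equiv_sym f g : cech_equiv f g -> cech_equiv g f.
Proof.
move=> [W [r [s [cW rP sP /coboundaryN fg]]]]; exists W, s, r; split => //.
by apply: (coboundary_ext _ (fg)) => A B; rewrite opprB.
Qed.

Lemma cech_equiv_trans f g k :
  cech_equiv f g -> cech_equiv g k -> cech_equiv f k.
Proof.
move=> [V [r [s [cV rP sP fg]]]] [W [s' [t [cW s'P tP gk]]]].
have pl := @refine_meetl V W; have pr := @refine_meetr V W.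
exists (cover_meet V W), (r \o refine V), (t \o refine W); split.
- exact: open_cover_meet.
- exact: refinement_comp pl.
- exact: refinement_comp pr.
have := pullback_indep (refinement_comp sP pl) (refinement_comp s'P pr)
  (@cc_is_cocycle g).
move/(coboundaryD (coboundary_pullback pl fg)).
move/coboundaryD/(_ (coboundary_pullback pr gk)).
apply: coboundary_ext => A B /=.
by lia.
Qed.

Definition cech_rel : rel cech_cocycle := fun f g => `[< cech_equiv f g >].

Lemma cech_rel_refl : reflexive cech_rel.
Proof. by move=> f; apply/asboolP/cech_equiv_refl. Qed.

Lemma cech_rel_sym : symmetric cech_rel.
Proof.
by move=> f g; apply/idP/idP => /asboolP/cech_equiv_sym/asboolP.
Qed.

Lemma cech_rel_trans : transitive cech_rel.
Proof.
move=> g f k /asboolP fg /asboolP gk; apply/asboolP.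
exact: cech_equiv_trans gk.
Qed.

Canonical cech_equiv_rel :=
  EquivRel cech_rel cech_rel_refl cech_rel_sym cech_rel_trans.

Definition cech_H1 : Type := {eq_quot cech_equiv_rel}.
HB.instance Definition _ := Choice.on cech_H1.
HB.instance Definition _ : EqQuotient _ cech_equiv_rel cech_H1 :=
  EqQuotient.on cech_H1.

Definition cech_class (f : cech_cocycle) : cech_H1 := \pi_cech_H1 f.

Lemma cech_classP f g : cech_class f = cech_class g <-> cech_equiv f g.
Proof.
split=> [/eqquotP/asboolP//|fg]; exact/eqquotP/asboolP.
Qed.

Definition cech_pullback (f : cech_cocycle) W r (cW : open_cover W)
    (rP : refinement_map W (cc_cover f) r) : cech_cocycle :=
  CechCocycle cW (pullback_cocycle rP (@cc_is_cocycle f)).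

Definition cech_zero : cech_cocycle :=
  CechCocycle open_cover1 (@zero_cocycle _).

Definition cech_opp (f : cech_cocycle) : cech_cocycle :=
  CechCocycle (@cc_open_cover f) (opp_cocycle (@cc_is_cocycle f)).

(** The sum is formed on the common refinement [cover_meet]. *)
Definition cech_add (f g : cech_cocycle) : cech_cocycle :=
  CechCocycle (open_cover_meet (@cc_open_cover f) (@cc_open_cover g))
    (add_cocycle
      (pullback_cocycle (@refine_meetl _ _) (@cc_is_cocycle f))
      (pullback_cocycle (@refine_meetr _ _) (@cc_is_cocycle g))).

Definition H1_zero : cech_H1 := cech_class cech_zero.
Definition H1_opp (x : cech_H1) : cech_H1 := cech_class (cech_opp (repr x)).
Definition H1_add (x y : cech_H1) : cech_H1 :=
  cech_class (cech_add (repr x) (repr y)).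

Lemma cech_equiv_repr f : cech_equiv (repr (cech_class f)) f.
Proof. by apply/cech_classP; rewrite /cech_class reprK. Qed.

Lemma cech_pullback_equiv f W r cW rP :
  cech_equiv (@cech_pullback f W r cW rP) f.
Proof.
exists W, id, r; split => //=; first exact: refinement_id.
by apply: (coboundary_ext _ ((coboundary0 _))) => A B; rewrite subrr.
Qed.

(** On a common cover, the group operations are the pointwise ones. *)
Lemma H1_addE W (cW : open_cover W) f g (fP : is_cocycle1 W f)
    (gP : is_cocycle1 W g) :
  H1_add (cech_class (CechCocycle cW fP)) (cech_class (CechCocycle cW gP)) =
  cech_class (CechCocycle cW (add_cocycle fP gP)).
Proof.
rewrite /H1_add; apply/cech_classP.
have [V [r [s [cV rP sP fE]]]] := cech_equiv_repr (CechCocycle cW fP).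
have [V' [r' [s' [cV' r'P s'P gE]]]] := cech_equiv_repr (CechCocycle cW gP).
move: (repr (cech_class (CechCocycle cW fP))) rP fE => F rP fE.
move: (repr (cech_class (CechCocycle cW gP))) r'P gE => G r'P gE.
rewrite /= in fE gE sP s'P.
set M := cover_meet (cc_cover F) (cc_cover G).
have cM : open_cover M by apply: open_cover_meet; exact: cc_open_cover.
set N := cover_meet V V'.
have cN : open_cover N by exact: open_cover_meet.
have pl := @refine_meetl M N; have pr := @refine_meetr M N.
have ql := refinement_comp (@refine_meetl V V') pr.
have qr := refinement_comp (@refine_meetr V V') pr.
exists (cover_meet M N), (refine M), ((s \o refine V) \o refine N); split => //.
- exact: open_cover_meet.
- exact: (refinement_comp sP ql).
rewrite /=.
have ML := refinement_comp (@refine_meetl (cc_cover F) (cc_cover G)) pl.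
have MR := refinement_comp (@refine_meetr (cc_cover F) (cc_cover G)) pl.
have hF := pullback_indep ML (refinement_comp rP ql) (@cc_is_cocycle F).
have hG := pullback_indep MR (refinement_comp r'P qr) (@cc_is_cocycle G).
have hg := pullback_indep (refinement_comp s'P qr) (refinement_comp sP ql) gP.
have hfE := coboundary_pullback ql fE.
have hgE := coboundary_pullback qr gE.
have h1 := coboundaryD hF hfE.
have h2 := coboundaryD (coboundaryD hG hgE) hg.
apply: (coboundary_ext _ ((coboundaryD h1 h2))) => A B /=.
by lia.
Qed.

Lemma H1_oppE W (cW : open_cover W) f (fP : is_cocycle1 W f) :
  H1_opp (cech_class (CechCocycle cW fP)) =
  cech_class (CechCocycle cW (opp_cocycle fP)).
Proof.
apply/cech_classP.
have [V [r [s [cV rP sP /coboundaryN fE]]]] :=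
  cech_equiv_repr (CechCocycle cW fP).
exists V, r, s; split => //.
by apply: (coboundary_ext _ (fE)) => A B /=; rewrite opprB opprK addrC.
Qed.

Lemma cech_class_eq W (cW : open_cover W) f g (fP : is_cocycle1 W f)
    (gP : is_cocycle1 W g) : (forall A B, f A B = g A B) ->
  cech_class (CechCocycle cW fP) = cech_class (CechCocycle cW gP).
Proof.
move=> fg; apply/cech_classP; exists W, id, id; split => //=;
  [exact: refinement_id|exact: refinement_id|].
by apply: (coboundary_ext _ ((coboundary0 _))) => A B; rewrite fg subrr.
Qed.

Lemma H1_zeroE W (cW : open_cover W) :
  H1_zero = cech_class (CechCocycle cW (@zero_cocycle W)).
Proof.
apply/cech_classP; exists W, (fun=> setT), id; split => //=; first exact: refinement_id.
by apply: (coboundary_ext _ ((coboundary0 _))) => A B; rewrite subrr.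
Qed.

Lemma cech_class_on (x : cech_H1) W r (cW : open_cover W) :
  refinement_map W (cc_cover (repr x)) r ->
  exists f (fP : is_cocycle1 W f), x = cech_class (CechCocycle cW fP).
Proof.
move=> rP; exists (fun A B => repr x (r A) (r B)).
exists (pullback_cocycle rP (@cc_is_cocycle (repr x))).
rewrite -[LHS]reprK; apply/cech_classP/cech_equiv_sym.
exact: (cech_pullback_equiv cW rP).
Qed.

Lemma H1_common (x y z : cech_H1) : exists W (cW : open_cover W) f g h
    (fP : is_cocycle1 W f) (gP : is_cocycle1 W g) (hP : is_cocycle1 W h),
  [/\ x = cech_class (CechCocycle cW fP), y = cech_class (CechCocycle cW gP) &
      z = cech_class (CechCocycle cW hP)].
Proof.
pose c (x : cech_H1) := cc_cover (repr x).
have cP u : open_cover (c u) by exact: cc_open_cover.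
pose W := cover_meet (cover_meet (c x) (c y)) (c z).
have cW : open_cover W by do ![apply: open_cover_meet => //].
have pl := @refine_meetl (cover_meet (c x) (c y)) (c z).
have rx := refinement_comp (@refine_meetl (c x) (c y)) pl.
have ry := refinement_comp (@refine_meetr (c x) (c y)) pl.
have rz : refinement_map W (c z) _ := @refine_meetr _ _.
have [f [fP xE]] := cech_class_on cW rx.
have [g [gP yE]] := cech_class_on cW ry.
have [h [hP zE]] := cech_class_on cW rz.
by exists W, cW, f, g, h, fP, gP, hP.
Qed.

Lemma H1_addA : associative H1_add.
Proof.
move=> x y z; have [W [cW [f [g [h [fP [gP [hP [-> -> ->]]]]]]]]] :=
  H1_common x y z.
by rewrite !H1_addE; apply: cech_class_eq => A B; rewrite addrA.
Qed.

Lemma H1_addC : commutative H1_add.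
Proof.
move=> x y; have [W [cW [f [g [h [fP [gP [hP [-> -> _]]]]]]]]] :=
  H1_common x y x.
by rewrite !H1_addE; apply: cech_class_eq => A B; rewrite addrC.
Qed.

Lemma H1_add0 : left_id H1_zero H1_add.
Proof.
move=> x; have [W [cW [f [g [h [fP [gP [hP [-> _ _]]]]]]]]] := H1_common x x x.
by rewrite (H1_zeroE cW) !H1_addE; apply: cech_class_eq => A B; rewrite add0r.
Qed.

Lemma H1_addN : left_inverse H1_zero H1_opp H1_add.
Proof.
move=> x; have [W [cW [f [g [h [fP [gP [hP [-> _ _]]]]]]]]] := H1_common x x x.
rewrite H1_oppE H1_addE (H1_zeroE cW).
by apply: cech_class_eq => A B; rewrite addNr.
Qed.

HB.instance Definition _ :=
  GRing.isZmodule.Build cech_H1 H1_addA H1_addC H1_add0 H1_addN.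

End Cech.

(** * Isomorphism classes of abelian groups *)

Definition group_iso (G H : zmodType) : Prop :=
  exists f : {additive G -> H}, bijective f.

(** The isomorphism classes of a family of groups, each given by the set of
    indices of the groups in it; [set zmodType] would be a universe
    inconsistency. *)
Definition iso_classes (I : Type) (G : I -> zmodType) : set (set I) :=
  [set [set j | group_iso (G i) (G j)] | i in [set: I]].

(** * Mixed substitution systems *)

Record substitution (A : finType) := Substitution {
  subst_fun :> A -> seq A;
  subst_nonempty : forall a, subst_fun a != [::] }.

Definition subst_word (A : finType) (phi : substitution A) (w : seq A) : seq A :=
  flatten (map phi w).

(** [mss_bound] is the integer k of F = {phi_0, ..., phi_k}. *)
Record mixed_substitution_system := MixedSubstitutionSystem {
  mss_alphabet : finType;
  mss_bound : nat;
  mss_subst : 'I_mss_bound.+1 -> substitution mss_alphabet;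
  mss_seq : nat -> 'I_mss_bound.+1 }.

Section Hull.
Variable S : mixed_substitution_system.
Local Notation A := (mss_alphabet S).

(** phi_{s_m} o phi_{s_(m+1)} o ... o phi_{s_n}, acting on words. *)
Definition subst_between (m n : nat) : seq A -> seq A :=
  foldr (fun i F => subst_word (mss_subst (mss_seq S i)) \o F) id
    (index_iota m n.+1).

Definition full_shift : topologicalType := {ptws int -> discrete_topology A}.

(** The finite string a_t ... a_{t+u}. *)
Definition window (T : int -> A) (t : int) (u : nat) : seq A :=
  [seq T (t + i%:Z) | i <- iota 0 u.+1].

Definition admitted (T : int -> A) : Prop :=
  forall (t : int) (u : nat), exists (n : nat) (a : A),
    infix (window T t u) (subst_between 0 n [:: a]).

Definition hull : set full_shift := [set T | admitted T].

(** The [n]-th iterate of the left shift, for [n] an arbitrary integer. *)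
Definition left_shift (n : int) (T : int -> A) : int -> A := fun j => T (j + n).

Lemma hull_shift_subproof (n : int) (T : hull) : left_shift n (\val T) \in hull.
Proof.
rewrite inE => t u; have [m [a ma]] := set_valP T (t + n) u.
exists m, a; move: ma; congr (infix _ _).
by apply: eq_map => i; rewrite /left_shift addrAC.
Qed.

Definition hull_shift (n : int) (T : hull) : hull :=
  exist _ (left_shift n (\val T)) (hull_shift_subproof n T).

Lemma hull_shift0 T : hull_shift 0 T = T.
Proof.
by apply: val_inj; apply/funext => j; rewrite /= /left_shift addr0.
Qed.

Lemma hull_shiftD m n T : hull_shift m (hull_shift n T) = hull_shift (m + n) T.
Proof.
by apply: val_inj; apply/funext => j; rewrite /= /left_shift addrA.
Qed.

End Hull.

Arguments hull : clear implicits.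

(** * Tiling spaces *)

Section TilingSpace.
Variables (R : realType) (S : mixed_substitution_system).

Definition unit_interval : set R := `[0, 1].

Definition hull_cylinder : topologicalType :=
  ((hull S : Type) * (unit_interval : Type))%type.

Definition glue (x y : hull_cylinder) : Prop :=
  [/\ \val x.2 = 1, \val y.2 = 0 & y.1 = hull_shift 1 x.1].

(** The equivalence relation generated by [glue]; since the shift is injective
    no further identifications arise. *)
Definition susp_rel : rel hull_cylinder :=
  fun x y => `[< [\/ x = y, glue x y | glue y x] >].

Lemma glue_inj x x' y : glue x y -> glue x' y -> x = x'.
Proof.
case: x x' => [T t] [T' t'] [/= t1 _ yT] [/= t'1 _ yT'].
have -> : T = T' by rewrite -(hull_shift0 T) -(hull_shift0 T') -(addNr 1)
  -!hull_shiftD -yT -yT'.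
by congr pair; apply: val_inj; rewrite /= t1 t'1.
Qed.

Lemma glue_fun x y y' : glue x y -> glue x y' -> y = y'.
Proof.
case: y y' => [T t] [T' t'] [/= _ t0 TE] [/= _ t'0 T'E].
by rewrite TE T'E; congr pair; apply: val_inj; rewrite /= t0 t'0.
Qed.

Lemma glue_glue x y z : glue x y -> ~ glue y z.
Proof.
by move=> [_ y0 _] [y1 _ _]; move: (oner_neq0 R); rewrite -y1 y0 eqxx.
Qed.

Lemma susp_rel_refl : reflexive susp_rel.
Proof. by move=> x; apply/asboolP; constructor 1. Qed.

Lemma susp_rel_sym : symmetric susp_rel.
Proof.
suff h x y : susp_rel x y -> susp_rel y x by move=> x y; apply/idP/idP; exact: h.
move=> /asboolP[->|xy|yx]; apply/asboolP;
  by [constructor 1|constructor 3|constructor 2].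
Qed.

Lemma susp_rel_trans : transitive susp_rel.
Proof.
move=> y x z /asboolP[<-//|xy|yx] /asboolP[<-|yz|zy]; apply/asboolP.
- by constructor 2.
- by case: (glue_glue xy yz).
- by rewrite (glue_inj xy zy); constructor 1.
- by constructor 3.
- by rewrite (glue_fun yx yz); constructor 1.
- by case: (glue_glue zy yx).
Qed.

Definition susp_equiv :=
  EquivRel susp_rel susp_rel_refl susp_rel_sym susp_rel_trans.

Definition tiling_space : topologicalType :=
  quotient_topology {eq_quot susp_equiv}.

Definition tiling_class (x : hull_cylinder) : tiling_space :=
  \pi_({eq_quot susp_equiv}) x.

Lemma tiling_classP x y :
  tiling_class x = tiling_class y <-> [\/ x = y, glue x y | glue y x].
Proof. by split=> [/eqquotP/asboolP//|xy]; apply/eqquotP/asboolP. Qed.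

Lemma frac_subproof (x : R) : x - (Num.floor x)%:~R \in unit_interval.
Proof.
rewrite inE /unit_interval/= in_itv/= subr_ge0 floor_le/= lerBlDl.
by apply/ltW; rewrite -[1]/(1%:~R) -intrD floorD1_gt.
Qed.

Definition frac (x : R) : unit_interval :=
  exist (fun t : R => t \in unit_interval) _ (frac_subproof x).

Definition cylinder_flow (r : R) (x : hull_cylinder) : hull_cylinder :=
  (hull_shift (Num.floor (\val x.2 + r)) x.1, frac (\val x.2 + r)).

Definition translate (r : R) (q : tiling_space) : tiling_space :=
  tiling_class (cylinder_flow r (repr q)).

(** The formula defining [translate] does not depend on the representative,
    including representatives (T, 1). *)
Lemma translate_class r x :
  translate r (tiling_class x) = tiling_class (cylinder_flow r x).
Proof.
suff h y z : glue y z -> cylinder_flow r y = cylinder_flow r z.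
  have : tiling_class (repr (tiling_class x)) = tiling_class x.
    by rewrite /tiling_class reprK.
  by rewrite /translate; case/tiling_classP => [->|/h->|/h->].
case: y z => [T t] [T' t'] [/= t1 t0 ->].
have fE : Num.floor (1 + r) = Num.floor (0 + r) + 1.
  by rewrite addrC floorDrz ?rpred1// floor1 add0r.
rewrite /cylinder_flow/= t1 t0 hull_shiftD fE; congr pair.
by apply: val_inj; rewrite /= fE intrD add0r [1 + r]addrC opprD addrACA subrr addr0.
Qed.

Definition translation_orbit (q : tiling_space) : set tiling_space :=
  range (translate^~ q).

Definition minimal_tiling_space : Prop :=
  forall q : tiling_space, dense (translation_orbit q).

End TilingSpace.

(* Main.v *)
(** Over the alphabet {a, b}, take phi : a -> a, b -> ba and
    psi : a -> ab, b -> ba.  Then phi^n o psi sends a to a b a^n and b to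
    b a^(n+1), so it has constant length n + 2: choosing the numbers of phi
    between consecutive psi produces stages of arbitrary lengths, and the words
    of level i have length l_i, the product of the first i of them.

    Let e in H^1(Omega) be the pullback of the generator of H^1(R/Z) along
    (T, t) |-> t.  For m > 0, e is divisible by m iff the shift on the hull has a
    locally constant eigenfunction kappa : Sigma -> Z/m, that is
    kappa(sigma T) = kappa(T) + 1.  One direction lifts kappa(T) + t from R/mZ;
    for the other, a 0-cochain trivialising e modulo m is locally constant along
    flow segments once corrected by t.  For the systems above such a kappa exists
    iff m divides some l_i: the word of level i coming from b a recurs only at
    multiples of l_i, while some point T is the limit of sigma^(l_i) T.

    Omega is compact with countable base, so H^1(Omega) is countable, and a group
    isomorphic to it has only countably many sets {m | m divides x}.  Prescribing
    which primes divide the l_i gives uncountably many such sets for x = e. *)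

Require Import Defs.
From HB Require Import structures.
From mathcomp Require Import all_boot all_order all_algebra.
From mathcomp Require Import all_classical all_reals topology num_topology.
From mathcomp Require Import subtype_topology quotient_topology function_spaces.
From mathcomp Require Import discrete_topology normedtype.
From mathcomp Require Import zify ring lra.
Set Implicit Arguments.
Unset Strict Implicit.
Unset Printing Implicit Defensive.
Import Order.TTheory GRing.Theory Num.Theory.
Import numFieldTopology.Exports.
Local Open Scope classical_set_scope.
Local Open Scope ring_scope.

(** * Countability of Cech cohomology *)

Definition countable_base (X : topologicalType) (K : countType)
    (B : K -> set X) : Prop :=
  (forall k, open (B k)) /\
  forall x A, open A -> A x -> exists2 k, B k x & B k `<=` A.

Lemma cech_class_eq_in (X : topologicalType) (W : set (set X))
    (cW : open_cover W) f g (fP : is_cocycle1 W f) (gP : is_cocycle1 W g) :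
  (forall A B, W A -> W B -> f A B = g A B) ->
  cech_class (CechCocycle cW fP) = cech_class (CechCocycle cW gP).
Proof.
move=> fg; apply/cech_classP; exists W, id, id; split => //=;
  [exact: refinement_id|exact: refinement_id|].
by exists (fun=> 0) => A B WA WB _; rewrite fg// subrr.
Qed.

(** Compactness in its near-covering form, applied to the filter of finite index lists ordered by
    inclusion. *)
Lemma compact_subcover (X : topologicalType) (K : choiceType) (J : set K)
    (B : K -> set X) : compact [set: X] ->
  (forall k, J k -> open (B k)) -> (forall x, exists2 k, J k & B k x) ->
  exists2 s : seq K, (forall k, k \in s -> J k) &
    forall x, exists2 k, k \in s & B k x.
Proof.
move=> /compact_near_coveringP cX oB cB.
pose up (s : seq K) := [set s' : seq K | {subset s <= s'} /\
  forall k, k \in s' -> J k].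
pose F := filter_from [set s : seq K | forall k, k \in s -> J k] up.
have FF : Filter F.
  apply: filter_from_filter; first by exists [::].
  move=> s t sJ tJ; exists (s ++ t) => [k|u [su uJ]].
    by rewrite mem_cat => /orP[/sJ|/tJ].
  by split; split=> // k ks; apply: su; rewrite mem_cat ks ?orbT.
have [] := cX _ F (fun s x => exists2 k, k \in s & B k x) FF.
  move=> x _; have [k Jk Bkx] := cB x.
  exists (B k, up [:: k]); first split => /=.
  - by apply: open_nbhs_nbhs; split=> //; exact: oB.
  - by exists [:: k] => // k'; rewrite inE => /eqP ->.
  by move=> [y s] /= [Bky [ks _]]; exists k => //; apply: ks; rewrite inE.
move=> s sJ sup; exists s => // x.
by have := sup s; apply=> //; split.
Qed.

(** By compactness every class lives on a finite cover by basic sets, where a cocycle is a finite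
    table of integers; there are only countably many pairs of a list and a table. *)
Lemma countable_cech_H1 (X : topologicalType) (K : countType)
    (B : K -> set X) : compact [set: X] -> countable_base B ->
  countable [set: cech_H1 X].
Proof.
move=> cX [oB bB].
pose cov (s : seq K) : set (set X) := [set B k | k in [set` s]].
pose idx (s : seq K) (C : set X) := find (fun k => `[< B k = C >]) s.
pose tab (s : seq K) (t : seq int) C D :=
  nth 0 t (idx s C * size s + idx s D)%N.
(* Pairs that do not describe a cocycle on a cover are sent to 0. *)
pose decode (p : seq K * seq int) : cech_H1 X :=
  if pselect (open_cover (cov p.1)) is left cW then
    if pselect (is_cocycle1 (cov p.1) (tab p.1 p.2)) is left fP
    then cech_class (CechCocycle cW fP) else 0
  else 0.
apply: (@sub_countable _ _ _ [set: seq K * seq int]); last exact: countableP.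
suff -> : [set: cech_H1 X] = range decode by exact: card_image_le.
apply/esym; rewrite -subTset => x _.
set U := cc_cover (repr x); have [oU cU] : open_cover U := @cc_open_cover _ _.
pose J := [set k | exists2 A, U A & B k `<=` A].
have [k _||s sJ cs] := compact_subcover (J := J) (B := B) cX; first exact: oB.
  move=> y; have [A UA Ay] : (\bigcup_(A in U) A) y by rewrite cU.
  by have [k Bky BkA] := bB _ _ (oU _ UA) Ay; exists k => //; exists A.
have cW : open_cover (cov s).
  split=> [_ [k _ <-]|]; first exact: oB.
  rewrite -subTset => y _; have [k ks Bky] := cs y.
  by exists (B k) => //; exists k.
have rP : refinement_map (cov s) U (refine U).
  apply: refineP => _ [k ks <-].
  by have [A UA BkA] := sJ _ ks; exists A.
have [f [fP xE]] := cech_class_on cW rP.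
pose el i := nth set0 [seq B k | k <- s] i.
pose n := size s.
pose t := mkseq (fun j => f (el (j %/ n)%N) (el (j %% n)%N)) (n * n).
have idxP C : cov s C -> (idx s C < n)%N /\ el (idx s C) = C.
  move=> [k ks <-].
  have hs : has (fun k' => `[< B k' = B k >]) s.
    by apply/hasP; exists k => //; apply/asboolP.
  split; first by rewrite /idx -has_find.
  have /asboolP := nth_find k hs.
  by rewrite /el (nth_map k) -?has_find.
have tabE C D' : cov s C -> cov s D' -> tab s t C D' = f C D'.
  move=> /idxP[iC eC] /idxP[iD eD]; rewrite /tab /t -/n nth_mkseq; last by nia.
  have n0 : (0 < n)%N by lia.
  by rewrite divnMDl// divn_small// modnMDl modn_small// addn0 eC eD.
have tP : is_cocycle1 (cov s) (tab s t).
  by move=> A C D' sA sC sD ?; rewrite !tabE//; exact: (fP A C D').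
exists (s, t) => //; rewrite /decode /=.
case: pselect => // cW'; case: pselect => // tP'.
rewrite xE (Prop_irrelevance cW' cW); apply: cech_class_eq_in => A C sA sC.
exact: tabE.
Qed.

(** * Topology of the tiling space *)

Section Agreement.
Variable S : mixed_substitution_system.
Implicit Types (T : int -> mss_alphabet S) (N : nat).

Definition agree N T T' : Prop := forall j : int, (`|j| <= N)%N -> T j = T' j.

Lemma agree_le N M T1 T2 : (N <= M)%N -> agree M T1 T2 -> agree N T1 T2.
Proof. by move=> NM h j jN; rewrite h// (leq_trans jN). Qed.

Lemma nbhs_agree N (T : full_shift S) :
  nbhs T [set T' : full_shift S | agree N T T'].
Proof.
have Tj j : nbhs T [set T' : full_shift S | T j = T' j].
  have /= := @proj_continuous int (fun=> discrete_topology (mss_alphabet S)) j T.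
  apply.
  by rewrite nbhs_principalE; apply/principal_filterP.
pose r : seq int := [seq (i%:Z - N%:Z) | i <- iota 0 (N + N).+1].
have rP (j : int) : (`|j| <= N)%N -> j \in r.
  move=> jN; apply/mapP; exists `|(j + N%:Z)%R|%N; last by lia.
  by rewrite mem_iota; lia.
apply: (@filterS _ _ _ [set T' : full_shift S | forall j, j \in r -> T j = T' j]).
  by move=> T' h j /rP; exact: h.
elim: r {rP} => [|j r IH]; first by apply: filterS filterT => T' _ j.
by apply: filterS2 (Tj j) IH => T' Tj' h i; rewrite inE => /orP[/eqP ->|/h].
Qed.

(** The product topology is a supremum of initial topologies, so the filter generated by agreement
    on central windows converges as soon as it does in each coordinate. *)
Lemma nbhs_full_shift (T : full_shift S) (O : set (full_shift S)) :
  nbhs T O -> exists N, forall T' : full_shift S, agree N T T' -> O T'.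
Proof.
pose F : set_system (full_shift S) :=
  filter_from [set: nat] (fun N => [set T' | agree N T T']).
have FF : Filter F.
  apply: filter_from_filter; first by exists 0%N.
  move=> N M _ _; exists (maxn N M) => // T' h; split;
    by apply: agree_le h; lia.
suff : F --> T by move=> /(_ O) FT /FT[N _ NO]; exists N => T' /NO.
apply/(@cvg_sup _ _ _ F) => j.
rewrite cvg_image; last first.
  rewrite -subTset => a _; exists (fun=> a) => //.
move=> A /=; rewrite nbhs_principalE => /principal_filterP Aj.
exists (proj j @^-1` A).
  by exists `|j|%N => // T' h /=; rewrite /proj -h.
apply: image_preimage; rewrite -subTset => a _; exists (fun=> a) => //.
Qed.

End Agreement.

Lemma nbhs_set_type (X : topologicalType) (A : set X) (x : A) (O : set A) :
  nbhs x O <-> exists2 W, nbhs (\val x) W & forall y : A, W (\val y) -> O y.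
Proof.
split.
  case=> _ /= [] [W oW <- /= Wx sWU]; exists W; first exact: open_nbhs_nbhs.
  by move=> y Wy; exact: sWU.
move=> [W]; rewrite nbhsE => -[V [oV Vx] VW] WO.
exists (\val @^-1` V); split => //=; first by exists V.
by move=> y /VW /WO.
Qed.

(** * Compactness and a countable base for the tiling space *)

Section Cylinder.
Variables (R : realType) (S : mixed_substitution_system).
Local Notation I01 := (@unit_interval R).
Local Notation Y := (hull_cylinder R S).

Lemma nbhs_hull (T : hull S) (O : set (hull S)) :
  nbhs T O <->
  exists N, forall T' : hull S, agree N (\val T) (\val T') -> O T'.
Proof.
rewrite nbhs_set_type; split=> [[W /nbhs_full_shift[N NW] WO]|[N NO]].
  by exists N => T' /NW/WO.
by exists [set T' : full_shift S | agree N (\val T) T'] => //; exact: nbhs_agree.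
Qed.

Lemma nbhs_unit_interval (t : I01) (O : set I01) :
  nbhs t O <-> exists2 e : R, 0 < e &
    forall t' : I01, `|\val t' - \val t| < e -> O t'.
Proof.
rewrite nbhs_set_type; split=> [[W /nbhs_ballP[e/= e0 eW] WO]|[e e0 eO]].
  by exists e => // t' h; apply: WO; apply: eW; rewrite /ball/= distrC.
exists (ball (\val t) e); first exact: nbhsx_ballx.
by move=> t' h; apply: eO; rewrite distrC.
Qed.

Lemma nbhs_cylinder (x : Y) (O : set Y) :
  nbhs x O <-> exists N, exists2 e : R, 0 < e & forall y : Y,
    agree N (\val x.1) (\val y.1) -> `|\val y.2 - \val x.2| < e -> O y.
Proof.
split=> [[[U V] /= [/nbhs_hull[N NU] /nbhs_unit_interval[e e0 eV]] UVO]|].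
  by exists N, e => // y /NU Uy /eV Vy; exact: UVO.
move=> [N [e e0 h]].
exists ([set T | agree N (\val x.1) (\val T)],
        [set t | `|\val t - \val x.2| < e]) => /=.
  by split; [apply/nbhs_hull; exists N|apply/nbhs_unit_interval; exists e].
by move=> y [/= ? ?]; exact: h.
Qed.

Lemma open_tilingP (O : set (tiling_space R S)) :
  open O <-> open (@tiling_class R S @^-1` O).
Proof. by []. Qed.

Lemma tiling_class_continuous : continuous (@tiling_class R S).
Proof. exact: pi_continuous. Qed.

Lemma tiling_classK (q : tiling_space R S) : tiling_class (repr q) = q.
Proof. by rewrite /tiling_class reprK. Qed.

Lemma nbhs_windowP (T : full_shift S) t u :
  nbhs T [set T' : full_shift S | window T' t u = window T t u].
Proof.
apply: filterS (nbhs_agree (`|t| + u) T) => T' h.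
apply/eq_in_map => i; rewrite mem_iota => /andP[_ iu]; apply/esym/h.
by lia.
Qed.

(** Failure of admission is visible in a single window, hence an open condition. *)
Lemma hull_closed : closed (hull S).
Proof.
rewrite -openC openE => T nT; rewrite /interior.
have /existsNP[t /existsNP[u nTtu]] : ~ admitted T by [].
by apply: filterS (nbhs_windowP T t u) => T' E /(_ t u); rewrite E.
Qed.

Lemma full_shift_compact : compact [set: full_shift S].
Proof.
have := @tychonoff int (fun=> discrete_topology (mss_alphabet S)) (fun=> setT).
have -> : [set f : int -> discrete_topology (mss_alphabet S) |
    forall i, [set: discrete_topology (mss_alphabet S)] (f i)] = setT.
  by apply/seteqP; split.
apply=> _; apply: finite_compact.
exact: (@finite_finset (mss_alphabet S)).
Qed.

Lemma compact_set_type (X : topologicalType) (A : set X) :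
  compact A -> compact [set: A].
Proof.
move=> cA; apply/compact_near_coveringP => I F P FF cov.
have /compact_near_coveringP/(_ I F (fun i x => forall y : A, \val y = x -> P i y)) := cA.
move=> /(_ FF) h.
have {}h : \near F, A `<=` (fun x => forall y : A, \val y = x -> P F y).
  apply: h => x Ax.
  have [[U V] /= [nU FV] UVP] := cov (exist _ x (mem_set Ax)) Logic.I.
  have /nbhs_set_type[W nW WU] := nU.
  exists (W, V); first by split.
  move=> [x' i] /= [Wx' Vi] y yx'.
  by apply: (UVP (y, i)); split=> //=; apply: WU; move: Wx'; rewrite -yx'.
by apply: filterS h => i h y _; apply: h (set_valP y) _ _.
Qed.

Lemma cylinder_compact : compact [set: Y].
Proof.
have h1 : compact [set: hull S].
  apply: compact_set_type.
  exact: subclosed_compact hull_closed full_shift_compact (@subsetT _ _).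
have h2 : compact [set: I01] by apply: compact_set_type; exact: segment_compact.
by have := compact_setX h1 h2; rewrite setXTT.
Qed.

Lemma tiling_space_compact : compact [set: tiling_space R S].
Proof.
have -> : [set: tiling_space R S] = @tiling_class R S @` [set: Y].
  by apply/esym; rewrite -subTset => q _; exists (repr q) => //; exact: tiling_classK.
apply: continuous_compact cylinder_compact.
by apply: continuous_subspaceT; exact: tiling_class_continuous.
Qed.

Lemma unit_interval_subproof (t : R) : 0 <= t <= 1 -> t \in I01.
Proof. by move=> h; rewrite inE /unit_interval/= in_itv. Qed.

Definition unit_point (t : R) (h : 0 <= t <= 1) : I01 :=
  exist (fun t : R => t \in I01) t (unit_interval_subproof h).

Lemma unit_intervalP (t : I01) : 0 <= \val t <= 1.
Proof. by have := set_valP t; rewrite /unit_interval/= in_itv. Qed.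

Lemma unit0_subproof : 0 <= (0 : R) <= 1. Proof. by rewrite lexx ler01. Qed.
Lemma unit1_subproof : 0 <= (1 : R) <= 1. Proof. by rewrite lexx ler01. Qed.
Definition unit0 := unit_point unit0_subproof.
Definition unit1 := unit_point unit1_subproof.

Lemma glue_unit (T : hull S) : Defs.glue ((T, unit1) : Y) (hull_shift 1 T, unit0).
Proof. by split. Qed.

Lemma tiling_class_fiber (x y : Y) : tiling_class x = tiling_class y ->
  [\/ x = y, \val y.2 = 0 /\ x = (hull_shift (-1) y.1, unit1) |
      \val y.2 = 1 /\ x = (hull_shift 1 y.1, unit0)].
Proof.
case/tiling_classP => [->|[x1 y0 E]|[y1 x0 E]]; first by constructor 1.
- constructor 2; split=> //; rewrite E hull_shiftD addNr hull_shift0.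
  by rewrite [LHS]surjective_pairing; congr pair; apply: val_inj.
- constructor 3; split=> //; rewrite -E.
  by rewrite [LHS]surjective_pairing; congr pair; apply: val_inj.
Qed.

Lemma hull_shiftNK (T : hull S) : hull_shift 1 (hull_shift (-1) T) = T.
Proof. by rewrite hull_shiftD subrr hull_shift0. Qed.

Lemma tiling_class_shift (T : hull S) :
  tiling_class ((hull_shift 1 T, unit0) : Y) = tiling_class ((T, unit1) : Y).
Proof. by apply/tiling_classP; constructor 3; exact: glue_unit. Qed.

Lemma agree_shift (n : int) N (T T' : hull S) : agree (N + `|n|) (\val T) (\val T') ->
  agree N (\val (hull_shift n T)) (\val (hull_shift n T')).
Proof. by move=> h j jN; rewrite /= /left_shift; apply: h; lia. Qed.

Lemma window_agree (T T' : int -> mss_alphabet S) N :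
  agree N T T' <-> window T (- N%:Z) (N + N) = window T' (- N%:Z) (N + N).
Proof.
split=> [h|/eq_in_map h j jN].
  by apply/eq_in_map => i; rewrite mem_iota => /andP[_ iN]; apply: h; lia.
have := h `|(j + N%:Z)%R|%N; rewrite mem_iota => E.
have -> : j = - N%:Z + `|(j + N%:Z)%R|%N%:Z by lia.
by apply: E; lia.
Qed.

Definition cylinder_base (k : nat * seq (mss_alphabet S) * (rat * rat)) : set Y :=
  [set x | window (\val x.1) (- k.1.1%:Z) (k.1.1 + k.1.1) = k.1.2 /\
    ratr k.2.1 < \val x.2 < ratr k.2.2].

Lemma cylinder_baseP : countable_base cylinder_base.
Proof.
split=> [[[N w] [p q]]|x A oA Ax].
  rewrite openE => x /= [xw /= /andP[px xq]]; apply/nbhs_cylinder.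
  exists N, (Num.min (\val x.2 - ratr p) (ratr q - \val x.2)).
    by rewrite lt_min !subr_gt0 px.
  move=> y /window_agree E; rewrite lt_min !ltr_distlC => /andP[/andP[h1 h2] /andP[h3 h4]].
  split; first by rewrite /= -E.
  by move: h2 h3 => /= h2 h3; apply/andP; split; move: h2 h3; lra.
have /nbhs_cylinder[N [e e0 NA]] : nbhs x A by exact: open_nbhs_nbhs.
(* The rational endpoints may fall outside [0, 1], so heights 0 and 1 need no separate treatment. *)
have [p] : exists q : rat, ratr q \in `](\val x.2 - e), (\val x.2)[.
  by apply: rat_in_itvoo; rewrite ltrBlDr ltrDl.
rewrite in_itv/= => /andP[p1 p2].
have [q] : exists q : rat, ratr q \in `](\val x.2), (\val x.2 + e)[.
  by apply: rat_in_itvoo; rewrite ltrDl.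
rewrite in_itv/= => /andP[q1 q2].
exists ((N, window (\val x.1) (- N%:Z) (N + N)), (p, q)).
  by split=> //=; rewrite p2 q1.
move=> y [/= /esym/window_agree Ny /andP[py yq]]; apply: NA => //.
by rewrite ltr_distl; move: p1 p2 q1 q2 py yq => /= *; apply/andP; split; lra.
Qed.

(** Since the quotient map is not open, a basic set consists of the points whose
    whole fibre lies in a finite union of basic sets of the cylinder. *)
Definition tiling_base (l : seq (nat * seq (mss_alphabet S) * (rat * rat))) :
    set (tiling_space R S) :=
  [set q | forall x, tiling_class x = q -> exists2 k, k \in l & cylinder_base k x].

Lemma tiling_baseP : countable_base tiling_base.
Proof.
have [oB bB] := cylinder_baseP; split=> [l|q O oO Oq].
  apply/open_tilingP; pose V : set Y := [set x | exists2 k, k \in l & cylinder_base k x].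
  have oV : open V.
    rewrite openE => x [k kl Bx].
    have : nbhs x (cylinder_base k) by apply: open_nbhs_nbhs.
    by apply: filterS => y By; exists k.
  have shiftV n (c : I01) (y : Y) : V (hull_shift n y.1, c) ->
      nbhs y [set y' : Y | V (hull_shift n y'.1, c)].
    move=> Vy; have /nbhs_cylinder[N [e e0 h]] : nbhs (hull_shift n y.1, c) V.
      by apply: open_nbhs_nbhs.
    apply/nbhs_cylinder; exists (N + `|n|)%N, e => // y' yy' _.
    by apply: h => /=; [exact: agree_shift|rewrite subrr normr0].
  have neqV (r : R) (y : Y) : \val y.2 != r -> nbhs y [set y' : Y | \val y'.2 != r].
    move=> yr; apply/nbhs_cylinder; exists 0%N, `|\val y.2 - r|.
      by rewrite normr_gt0 subr_eq0.
    by move=> y' _; apply: contraTneq => ->; rewrite distrC ltxx.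
  rewrite openE => y yV; rewrite /interior.
  (* Besides the point itself, a fibre can contain only its partner across the seam. The conditions
     on partners are vacuous near [y] unless its height is 0, respectively 1. *)
  have n1 : nbhs y V by apply: open_nbhs_nbhs; split=> //; exact: (yV y erefl).
  have n2 : nbhs y [set y' : Y | \val y'.2 = 0 -> V (hull_shift (-1) y'.1, unit1)].
    have [y0|yn0] := eqVneq (\val y.2) 0.
      have Vy : V (hull_shift (-1) y.1, unit1); last first.
        by apply: filterS (shiftV _ _ _ Vy) => y' /= Vy' _.
      apply: (yV (hull_shift (-1) y.1, unit1)).
      rewrite -tiling_class_shift hull_shiftNK; congr tiling_class.
      by rewrite [RHS]surjective_pairing; congr pair; apply: val_inj.
    by apply: filterS (neqV 0 y yn0) => y' /= /eqP yn E; case: (yn E).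
  have n3 : nbhs y [set y' : Y | \val y'.2 = 1 -> V (hull_shift 1 y'.1, unit0)].
    have [y0|yn0] := eqVneq (\val y.2) 1.
      have Vy : V (hull_shift 1 y.1, unit0); last first.
        by apply: filterS (shiftV _ _ _ Vy) => y' /= Vy' _.
      apply: (yV (hull_shift 1 y.1, unit0)).
      rewrite tiling_class_shift; congr tiling_class.
      by rewrite [RHS]surjective_pairing; congr pair; apply: val_inj.
    by apply: filterS (neqV 1 y yn0) => y' /= /eqP yn E; case: (yn E).
  apply: filterS3 n1 n2 n3 => y' V1 V2 V3 x /tiling_class_fiber[->//|[? ->]|[? ->]].
    exact: V2.
  exact: V3.
have oO' : open (@tiling_class R S @^-1` O) by apply/open_tilingP.
have [k0 k0q k0O] := bB (repr q) _ oO' ltac:(by rewrite /= tiling_classK).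
(* A candidate partner outside the fibre of [q] imposes nothing; [k0] then serves as a filler. *)
have ex (x : Y) : exists2 k, cylinder_base k `<=` @tiling_class R S @^-1` O &
    tiling_class x = q -> cylinder_base k x.
  have [xq|xq] := pselect (tiling_class x = q); last by exists k0.
  have [k kx kO] := bB x _ oO' ltac:(by rewrite /= xq).
  by exists k.
have [k1 k1O k1q] := ex (hull_shift (-1) (repr q).1, unit1).
have [k2 k2O k2q] := ex (hull_shift 1 (repr q).1, unit0).
exists [:: k0; k1; k2].
  move=> x xq; have := xq; rewrite -{1}(tiling_classK q).
  case/tiling_class_fiber => [xE|[_ xE]|[_ xE]].
  - by exists k0; rewrite ?inE ?eqxx// xE.
  - by exists k1; rewrite ?inE ?eqxx ?orbT// xE; apply: k1q; rewrite -xE.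
  - by exists k2; rewrite ?inE ?eqxx ?orbT// xE; apply: k2q; rewrite -xE.
move=> q' /(_ (repr q') (tiling_classK q'))[k]; rewrite !inE.
rewrite -[in O _](tiling_classK q') => /or3P[]/eqP->; [exact: k0O|exact: k1O|exact: k2O].
Qed.

Lemma countable_H1_tiling_space : countable [set: cech_H1 (tiling_space R S)].
Proof. exact: countable_cech_H1 tiling_space_compact tiling_baseP. Qed.

End Cylinder.

(** * Divisibility of the fundamental class *)

Lemma dvdz_subtrans (m a b c : int) :
  (m %| b - a)%Z -> (m %| c - b)%Z -> (m %| c - a)%Z.
Proof. by move=> ab bc; rewrite -(subrKA b) rpredD. Qed.

(** * Rounding to integers and connectedness of the interval *)

Section Round.
Variable R : realType.

Definition round_int (r : R) : int := Num.floor (r + 2%:R^-1).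

Lemma round_intE (r : R) (k : int) : `|r - k%:~R| < 2%:R^-1 -> round_int r = k.
Proof.
rewrite ltr_distl => /andP[h1 h2]; apply: floor_def.
by rewrite intrD; apply/andP; split; move: h1 h2; lra.
Qed.

Lemma round_intB1 (r : R) : round_int (r - 1) = round_int r - 1.
Proof.
rewrite /round_int addrAC (_ : - 1 = (-1)%:~R); last by rewrite mulrN1z.
by rewrite floorDrz ?intrKfloor// intr_int.
Qed.

Lemma intr_close (k l : int) : `|k%:~R - l%:~R : R| < 1 -> k = l.
Proof.
rewrite -intrB -intr_norm -[1]/(1%:~R) ltr_int => h; lia.
Qed.

Lemma clamp_subproof (t : R) : 0 <= Num.max 0 (Num.min t 1) <= 1.
Proof. by rewrite le_max lexx /= ge_max ler01 ge_min lexx orbT. Qed.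

Definition clamp (t : R) : @unit_interval R := unit_point (clamp_subproof t).

Lemma clamp_unit (t : @unit_interval R) : clamp (\val t) = t.
Proof.
have /andP[t0 t1] := unit_intervalP t.
by apply: val_inj; rewrite /= min_l// max_r.
Qed.

Lemma clamp_lip (t t' : R) : `|\val (clamp t') - \val (clamp t)| <= `|t' - t|.
Proof.
have h1 := ler_norm (t' - t); have h2 := ler_norm (t - t').
rewrite distrC in h2; rewrite ler_norml /= /Num.max /Num.min.
by case: (ltP t' 1) => ?; case: (ltP t 1) => ?; do 2!case: ltP => ?;
  apply/andP; split; lra.
Qed.

(** Once [clamp] has extended [v] to the whole line, the parameters at which it is congruent to its
    value at 0 form a clopen set, and [0, 1] is connected. *)
Lemma connected_mod (m : nat) (v : @unit_interval R -> int) :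
  (forall t, exists2 e : R, 0 < e &
    forall t' : @unit_interval R, `|\val t' - \val t| < e -> (m %| v t' - v t)%Z) ->
  (m %| v (unit1 R) - v (unit0 R))%Z.
Proof.
move=> vP; pose E := [set t : R | (m %| v (clamp t) - v (unit0 R))%Z].
have near_v (t : R) : nbhs t [set t' | (m %| v (clamp t') - v (clamp t))%Z].
  have [e e0 he] := vP (clamp t); apply/nbhs_ballP; exists e => // t'.
  rewrite /ball/= distrC => tt'; apply: he.
  exact: le_lt_trans (clamp_lip _ _) tt'.
have oE : open E.
  rewrite openE => t Et; apply: filterS (near_v t) => t' /= h.
  exact: dvdz_subtrans Et h.
have cE : closed E.
  rewrite -openC openE => t nEt; apply: filterS (near_v t) => t' /= h Et'.
  apply: nEt; move: Et'; rewrite /E/= => Et'.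
  by apply: dvdz_subtrans Et' _; rewrite -opprB rpredN.
have h : `[0, 1]%classic `&` E = `[0, 1]%classic.
  apply: segment_connected; [|by exists E|by exists E].
  exists 0; split; first by rewrite /= in_itv/= lexx ler01.
  by rewrite /E/= -[0]/(\val (unit0 R)) clamp_unit subrr dvdz0.
have [_] : (`[0, 1]%classic `&` E) 1 by rewrite h /= in_itv/= lexx ler01.
by rewrite /E/= -[1]/(\val (unit1 R)) clamp_unit.
Qed.
End Round.

Lemma mulrn_cocycle (X : topologicalType) (U : set (set X)) f (n : nat) :
  is_cocycle1 U f -> is_cocycle1 U (fun A B => f A B *+ n).
Proof.
by move=> fP A B C UA UB UC h; rewrite -mulrnBl -mulrnDl fP// mul0rn.
Qed.

Lemma cech_class_mulrn (X : topologicalType) (W : set (set X))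
    (cW : open_cover W) f (fP : is_cocycle1 W f) n :
  cech_class (CechCocycle cW fP) *+ n =
  cech_class (CechCocycle cW (mulrn_cocycle n fP)).
Proof.
elim: n => [|n IH].
  rewrite mulr0n -[0]/(H1_zero X) (H1_zeroE cW).
  exact: cech_class_eq.
rewrite mulrS IH -[_ + _]/(H1_add _ _) H1_addE.
by apply: cech_class_eq => A B; rewrite mulrS.
Qed.

(** * Circle-valued maps and their winding cocycles *)

Section Winding.
Variables (R : realType) (S : mixed_substitution_system).
Local Notation Y := (hull_cylinder R S).
Local Notation Omega := (tiling_space R S).
Implicit Types (kappa : hull S -> int) (m : nat) (x y : Y) (c : R).

(** [kappa] stands for a function to Z/m: both conditions see its values only modulo [m]. *)
Definition eigenfunction m kappa : Prop :=
  (forall T, (m %| kappa (hull_shift 1 T) - (kappa T + 1))%Z) /\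
  forall T, exists N, forall T', agree N (\val T) (\val T') ->
    (m %| kappa T' - kappa T)%Z.

Lemma eigenfunction1 : eigenfunction 1 (fun=> 0).
Proof. by split=> [T|T]; [|exists 0%N => T' _]; rewrite dvd1z. Qed.

(** [k] selects the lift of [kappa x.1 + x.2], a point of R/mZ, close to [c];
    it is unique for [m > 0]. *)
Definition lifts m kappa c x (k : int) : Prop :=
  `|(kappa x.1)%:~R + \val x.2 + (k * m%:Z)%:~R - c| < 4%:R^-1.

(** For an eigenfunction [kappa], the preimage of the arc of radius 1/4 about [c] under the map (T,
    t) |-> kappa(T) + t to the circle R/mZ. *)
Definition arc m kappa c : set Omega :=
  [set q | exists k, lifts m kappa c (repr q) k].

Definition arcs m kappa : set (set Omega) := range (arc m kappa).

(** Cochains take sets as arguments, so a centre has to be recovered from the arc. It is not unique: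
    c and c + m give the same arc. *)
Definition centre m kappa (A : set Omega) : R :=
  xget 0 [set c | A = arc m kappa c].

(** The difference, in units of [m], between the lifts to R of the circle map over [A] and over [B]:
    the pullback of a generator of H^1(R/mZ). *)
Definition winding m kappa (A B : set Omega) : int :=
  round_int ((centre m kappa B - centre m kappa A) / m%:R).

Lemma centreP m kappa A : arcs m kappa A -> A = arc m kappa (centre m kappa A).
Proof.
move=> [c _ cA]; rewrite /centre.
by apply: (@xgetPex _ _ [set c | A = arc m kappa c]); exists c.
Qed.

(** Across the seam the height drops by 1 while [kappa] rises by 1 up to a multiple of [m], which a
    change of [k] absorbs. *)
Lemma lifts_glue m kappa c x y : eigenfunction m kappa -> Defs.glue x y ->
  (exists k, lifts m kappa c x k) <-> exists k, lifts m kappa c y k.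
Proof.
move=> [ks _] [x1 y0 yE]; have /dvdzP[l lE] := ks x.1.
have {lE} lE : kappa y.1 = kappa x.1 + 1 + l * m%:Z by rewrite yE; lia.
rewrite /lifts lE x1 y0 !intrD; split=> -[k kP].
  exists (k - l); move: kP; rewrite mulrBl !intrB; congr (`|_| < _).
  by rewrite -[1%:~R]/(1 : R); lra.
exists (k + l); move: kP; rewrite mulrDl !intrD; congr (`|_| < _).
by rewrite -[1%:~R]/(1 : R); lra.
Qed.

Lemma arcP m kappa c x : eigenfunction m kappa ->
  arc m kappa c (tiling_class x) <-> exists k, lifts m kappa c x k.
Proof.
move=> kP; have := tiling_classK (tiling_class x).
rewrite /arc/= => /tiling_classP[->//|g|g]; first exact: lifts_glue.
exact: iff_sym (lifts_glue c kP g).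
Qed.

Lemma arcs_cover m kappa : eigenfunction m kappa -> open_cover (arcs m kappa).
Proof.
move=> kP; split=> [_ [c _ <-]|].
  apply/open_tilingP; rewrite openE => x /=; rewrite arcP// => -[k kx].
  have [N NP] := kP.2 x.1.
  apply/nbhs_cylinder; exists N.
  (* This is the room left in the strict inequality; nearby, [kappa] changes only by a multiple of
     [m]. *)
  exists (4%:R^-1 - `|(kappa x.1)%:~R + \val x.2 + (k * m%:Z)%:~R - c|).
    by rewrite subr_gt0.
  move=> y /NP/dvdzP[l lE] yx /=; rewrite arcP//; exists (k - l).
  have {lE} lE : kappa y.1 = kappa x.1 + l * m%:Z by lia.
  rewrite /lifts lE mulrBl intrB intrD.
  move: yx; rewrite ltrBrDr; apply: le_lt_trans.
  apply: le_trans (ler_normD _ _); rewrite le_eqVlt; apply/orP; left.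
  by apply/eqP; congr `|_|; lra.
apply/seteqP; split=> // q _; exists (arc m kappa (\val (repr q).2 + (kappa (repr q).1)%:~R)).
  by exists (\val (repr q).2 + (kappa (repr q).1)%:~R).
by exists 0; rewrite /lifts mul0r addr0 [X in X - _]addrC subrr normr0 invr_gt0 ltr0n.
Qed.

(** Both centres lie within 1/4 of a lift of the same point, so their difference is (l - k)m up to
    an error below 1/2, which division by m >= 1 does not enlarge. *)
Lemma windingE m kappa A B x k l : (0 < m)%N ->
  lifts m kappa (centre m kappa A) x k -> lifts m kappa (centre m kappa B) x l ->
  winding m kappa A B = l - k.
Proof.
move=> m0; rewrite /lifts /winding; set a := centre m kappa A.
set b := centre m kappa B; move: (_ + \val x.2) => z.
have m1 : (1 : R) <= m%:R by rewrite ler1n.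
rewrite !intrM => ka lb; apply: round_intE.
have -> : (b - a) / m%:R - (l - k)%:~R =
    ((z + k%:~R * m%:R - a) - (z + l%:~R * m%:R - b)) / m%:R.
  by rewrite intrB; field; rewrite pnatr_eq0; lia.
rewrite normrM normfV (ger0_norm (ler0n _ _)) ltr_pdivrMr ?(lt_le_trans _ m1)//.
apply: (@lt_le_trans _ _ (2%:R^-1)); last by nra.
apply: le_lt_trans (ler_normB _ _) _; lra.
Qed.

Lemma arcs_lifts m kappa A x : eigenfunction m kappa -> arcs m kappa A ->
  A (tiling_class x) -> exists k, lifts m kappa (centre m kappa A) x k.
Proof. by move=> kP /centreP {1}->; rewrite arcP. Qed.

Lemma winding_cocycle m kappa : (0 < m)%N -> eigenfunction m kappa ->
  is_cocycle1 (arcs m kappa) (winding m kappa).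
Proof.
move=> m0 kP A B C UA UB UC [q]; rewrite -(tiling_classK q) => -[[Aq Bq] Cq].
have [k kA] := arcs_lifts kP UA Aq.
have [l lB] := arcs_lifts kP UB Bq.
have [n nC] := arcs_lifts kP UC Cq.
by rewrite (windingE m0 kA lB) (windingE m0 kA nC) (windingE m0 lB nC); lia.
Qed.

Definition winding_class m kappa (m0 : (0 < m)%N) (kP : eigenfunction m kappa) :
    cech_H1 Omega :=
  cech_class (CechCocycle (arcs_cover kP) (winding_cocycle m0 kP)).

(** The class e: for [m = 1] and [kappa = 0] the circle map is (T, t) |-> t. *)
Definition fundamental_class : cech_H1 Omega :=
  winding_class (ltn0Sn 0) eigenfunction1.

(** As [kappa] is integer valued, the map to R/mZ followed by R/mZ -> R/Z is (T, t) |-> t, and R/mZ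
    -> R/Z has degree [m]. *)
Lemma winding_class_mulrn m kappa (m0 : (0 < m)%N) (kP : eigenfunction m kappa) :
  winding_class m0 kP *+ m = fundamental_class.
Proof.
rewrite /winding_class cech_class_mulrn; apply/cech_classP.
pose s (A : set Omega) := arc 1 (fun=> 0) (centre m kappa A).
have sP A : arcs m kappa A -> A `<=` s A.
  move=> UA q; rewrite -(tiling_classK q) => Aq.
  have [k kA] := arcs_lifts kP UA Aq.
  apply/(arcP _ _ eigenfunction1).
  exists (kappa (repr q).1 + k * m%:Z); move: kA; congr (`|_| < _).
  by rewrite mulr1 intrD; lra.
exists (arcs m kappa), id, s; split=> /=.
- exact: arcs_cover.
- exact: refinement_id.
- by move=> A UA; split; [exists (centre m kappa A)|exact: sP].
(* The centre chosen for [s A] need not be the one chosen for [A]; the rounded discrepancy is, up to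
   sign, the required 0-cochain. *)
exists (fun A => - round_int (centre 1 (fun=> 0) (s A) - centre m kappa A)).
have key A x : arcs m kappa A -> A (tiling_class x) ->
    exists k l : int, [/\ lifts m kappa (centre m kappa A) x k,
    lifts 1 (fun=> 0) (centre 1 (fun=> 0) (s A)) x l &
    round_int (centre 1 (fun=> 0) (s A) - centre m kappa A) =
    l - (kappa x.1 + k * m%:Z)].
  move=> UA Ax; have [k kA] := arcs_lifts kP UA Ax.
  have sA : arcs 1 (fun=> 0) (s A) by exists (centre m kappa A).
  have [l lA] := arcs_lifts eigenfunction1 sA (sP _ UA _ Ax).
  exists k, l; split=> //; apply: round_intE; move: kA lA; rewrite /lifts mulr1.
  set a := centre m kappa A; set b := centre _ _ (s A).
  rewrite !ltr_norml intrB intrD mulr0z; move: (\val x.2) => t.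
  by move=> /andP[? ?] /andP[? ?]; apply/andP; split; lra.
move=> A B UA UB [q]; rewrite -(tiling_classK q) => -[Aq Bq].
have [k [l [kA lA ->]]] := key _ _ UA Aq.
have [k' [l' [kB lB ->]]] := key _ _ UB Bq.
by rewrite (windingE m0 kA kB) (windingE _ lA lB)//; lia.
Qed.

End Winding.

(** * Divisibility in cohomology and eigenfunctions *)

Section Divisibility.
Variables (R : realType) (S : mixed_substitution_system).
Local Notation Y := (hull_cylinder R S).
Local Notation Omega := (tiling_space R S).

(** Modulo [m], the cochain [h] trivialises the winding cocycle up to sign, so adding the lift index
    [u] makes [V] locally constant modulo [m] on the cylinder. Following one flow segment gives the
    eigenfunction equation for [V] at height 0. *)
Lemma eigenfunction_of_divisible (m : nat) (z : cech_H1 Omega) :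
  z *+ m = fundamental_class R S -> exists kappa : hull S -> int, eigenfunction m kappa.
Proof.
have [U [cU [f [_ [_ [fP [_ [_ [-> _ _]]]]]]]]] := H1_common z z z.
rewrite cech_class_mulrn /fundamental_class /winding_class.
move=> /cech_classP[W [r [s [[oW cW] /= rP sP [h hP]]]]].
pose P (q : Omega) := xget set0 [set A | W A /\ A q].
have PP q : W (P q) /\ P q q.
  have [A WA Aq] : (\bigcup_(A in W) A) q by rewrite cW.
  by apply: (@xgetPex _ _ [set A | W A /\ A q]); exists A.
pose c (q : Omega) := centre 1 (fun=> 0) (s (P q)).
pose u (x : Y) : int := round_int (c (tiling_class x) - \val x.2).
pose V (x : Y) : int := u x + h (P (tiling_class x)).
have lift1 (A : set Omega) (x : Y) : W A -> A (tiling_class x) ->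
    exists k, lifts 1 (fun=> 0) (centre 1 (fun=> 0) (s A)) x k.
  by move=> /sP[sA As] /As; apply: arcs_lifts; [exact: eigenfunction1|].
have uP x : lifts 1 (fun=> 0) (c (tiling_class x)) x (u x).
  have [WP Px] := PP (tiling_class x).
  have [k kx] := lift1 _ _ WP Px; rewrite (_ : u x = k)//.
  apply: round_intE; move: kx; rewrite /lifts mulr1 mulr0z -/(c _).
  move: (c _) (\val x.2) => a t; rewrite !ltr_norml => /andP[? ?].
  by apply/andP; split; lra.
have locV x : nbhs x [set y : Y | (m %| V y - V x)%Z].
  have [WP Px] := PP (tiling_class x); set A := P (tiling_class x).
  have nA : nbhs x (@tiling_class R S @^-1` A).
    apply: open_nbhs_nbhs; split=> //.
    by apply/open_tilingP; exact: oW.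
  have n4 : nbhs x [set y : Y | `|\val y.2 - \val x.2| < 4%:R^-1].
    by apply/nbhs_cylinder; exists 0%N, (4%:R^-1); rewrite ?invr_gt0 ?ltr0n.
  apply: filterS2 nA n4 => y /= Ay yx; have [WP' Py] := PP (tiling_class y).
  have [k kA] := lift1 _ _ WP Ay.
  (* Three errors below 1/4 separate the integers [k] and [u x], so they differ by less than 1. *)
  have kE : k = u x.
    apply: (@intr_close R); have := uP x; move: kA yx.
    rewrite /lifts /= !mulr1 mulr0z -/(c _) !ltr_norml => /andP[? ?] /andP[? ?] /andP[? ?].
    by apply/andP; split; lra.
  rewrite {}kE in kA.
  have E : winding 1 (fun=> 0) (s A) (s (P (tiling_class y))) = u y - u x.
    exact: windingE kA (uP y).
  have := hP A (P (tiling_class y)) WP WP' (ex_intro _ _ (conj Ay Py)).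
  rewrite E => E2; rewrite /V.
  have -> : u y + h (P (tiling_class y)) - (u x + h A) =
      f (r A) (r (P (tiling_class y))) *+ m.
    by rewrite (canRL (subrK _) E2) opprD addrACA addrC.
  by rewrite -mulr_natr natz dvdz_mull.
exists (fun T => V (T, unit0 R)); split=> T.
  (* The two arguments name the same point of [Omega]; only the rounding in [u] sees the heights 1
     and 0. *)
  have E : V (T, unit1 R) = V (hull_shift 1 T, unit0 R) - 1.
    rewrite /V /u -tiling_class_shift /=; set a := c _; set b := h _.
    by rewrite round_intB1 subr0 addrAC.
  have := @connected_mod R m (fun t => V (T, t)); rewrite E => D.
  rewrite opprD [- _ - 1]addrC addrA.
  apply: D => t; have /nbhs_cylinder[N [e e0 H]] := locV (T, t).
  by exists e => // t' tt'; exact: H.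
have /nbhs_cylinder[N [e e0 H]] := locV (T, unit0 R).
by exists N => T' TT'; apply: H => //=; rewrite subrr normr0.
Qed.

Lemma divisible_fundamental_class (m : nat) : (0 < m)%N ->
  (exists z : cech_H1 Omega, z *+ m = fundamental_class R S) <->
  exists kappa : hull S -> int, eigenfunction m kappa.
Proof.
move=> m0; split=> [[z]|[kappa kP]]; first exact: eigenfunction_of_divisible.
by exists (winding_class R m0 kP); exact: winding_class_mulrn.
Qed.

End Divisibility.

(** * The substitution systems *)

Section ConstantLength.
Local Open Scope nat_scope.
Variables (A : eqType) (a0 : A).
Implicit Types (u w : seq A) (F : A -> seq A).

Lemma infix_nthP u w : infix u w <-> exists2 p, p + size u <= size w &
  forall j, j < size u -> nth a0 w (p + j) = nth a0 u j.
Proof.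
split=> [/infixP[s [s' ->]]|[p pw E]].
  exists (size s) => [|j ju]; first by rewrite !size_cat; lia.
  by rewrite nth_cat ltnNge leq_addr /= addKn nth_cat ju.
apply/infixP; exists (take p w), (drop (p + size u) w).
rewrite -{1}(cat_take_drop p w); congr cat.
rewrite -{1}(cat_take_drop (size u) (drop p w)) drop_drop [size u + p]addnC.
congr cat; apply: (@eq_from_nth _ a0) => [|j].
  by rewrite size_takel// size_drop; lia.
by rewrite size_takel ?size_drop; [move=> ju; rewrite nth_take// nth_drop E|lia].
Qed.

Lemma flatten_map_flatten (B C : Type) (F : B -> seq C) (ss : seq (seq B)) :
  flatten (map F (flatten ss)) = flatten [seq flatten (map F s) | s <- ss].
Proof. by elim: ss => //= s ss IH; rewrite map_cat flatten_cat IH. Qed.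

Variables (l : nat) (F : A -> seq A).
Hypothesis sizeF : forall c, size (F c) = l.

Lemma size_flatten_const w : size (flatten (map F w)) = size w * l.
Proof. by elim: w => //= c w IH; rewrite size_cat sizeF IH mulSn. Qed.

Lemma nth_flatten_const w k d : k < size w -> d < l ->
  nth a0 (flatten (map F w)) (k * l + d) = nth a0 (F (nth a0 w k)) d.
Proof.
elim: w k => // c w IH [|k] /=; first by move=> _ dl; rewrite nth_cat sizeF dl.
move=> kw dl; rewrite nth_cat sizeF mulSn -addnA ltnNge leq_addr /= addKn.
exact: IH.
Qed.

End ConstantLength.

(** The letter a is [false] and the letter b is [true]. *)
Definition phi_fun (c : bool) : seq bool := if c then [:: true; false] else [:: false].
Definition psi_fun (c : bool) : seq bool := [:: c; ~~ c].
Lemma phi_nonempty c : phi_fun c != [::]. Proof. by case: c. Qed.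
Lemma psi_nonempty c : psi_fun c != [::]. Proof. by case: c. Qed.
Definition phi := @Substitution bool phi_fun phi_nonempty.
Definition psi := @Substitution bool psi_fun psi_nonempty.

Section System.
Local Open Scope nat_scope.
Variable n : nat -> nat.

(** [stage k = (i, r)] when the first [k] substitutions are [i] complete stages
    [phi^(n _) o psi] followed by [phi^r]. *)
Fixpoint stage (k : nat) : nat * nat :=
  if k is k'.+1 then
    let: (i, r) := stage k' in if r == n i then (i.+1, 0) else (i, r.+1)
  else (0, 0).

Definition system : mixed_substitution_system :=
  @MixedSubstitutionSystem bool 1 (fun i => if i == ord0 then phi else psi)
    (fun k => let: (i, r) := stage k in if r == n i then ord_max else ord0).

(** [phi^k o psi] *)
Definition tau (k : nat) (c : bool) : seq bool :=
  if c then true :: nseq k.+1 false else [:: false, true & nseq k false].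

(** The composite of the first [i] stages, the last of them acting first on [c]. *)
Fixpoint block (i : nat) (c : bool) : seq bool :=
  if i is j.+1 then flatten (map (block j) (tau (n j) c)) else [:: c].

Definition blocks i w := flatten (map (block i) w).

Definition len i := \prod_(j < i) (n j).+2.

Lemma size_tau k c : size (tau k c) = k.+2.
Proof. by case: c; rewrite /= size_nseq. Qed.

Lemma size_block i c : size (block i c) = len i.
Proof.
elim: i c => [|i IH] c /=; first by rewrite /len big_ord0.
by rewrite (size_flatten_const IH) size_tau /len big_ord_recr /= mulnC.
Qed.

Lemma size_blocks i w : size (blocks i w) = size w * len i.
Proof. exact: size_flatten_const (size_block i) w. Qed.

Lemma lenS i : len i.+1 = len i * (n i).+2.
Proof. by rewrite /len big_ord_recr. Qed.

Lemma len_gt0 i : 0 < len i.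
Proof. by elim: i => [|i IH]; [rewrite /len big_ord0|rewrite lenS muln_gt0 IH]. Qed.

Lemma nth_blocks i w k d : k < size w -> d < len i ->
  nth false (blocks i w) (k * len i + d) = nth false (block i (nth false w k)) d.
Proof. exact: nth_flatten_const (size_block i) _ _ _. Qed.

Lemma blocks_cat i u v : blocks i (u ++ v) = blocks i u ++ blocks i v.
Proof. by rewrite /blocks map_cat flatten_cat. Qed.

Lemma blocks1 i c : blocks i [:: c] = block i c.
Proof. by rewrite /blocks /= cats0. Qed.

Lemma blocksS i w : blocks i.+1 w = blocks i (flatten (map (tau (n i)) w)).
Proof. by rewrite /blocks flatten_map_flatten -map_comp. Qed.

Lemma blocks0 w : blocks 0 w = w.
Proof. by elim: w => //= c w IH; rewrite /blocks /= -/(blocks 0 w) IH. Qed.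

Lemma infix_blocks i u v : infix u v -> infix (blocks i u) (blocks i v).
Proof.
by move=> /infixP[s [s' ->]]; rewrite !blocks_cat; apply/infixP; do 2!eexists.
Qed.

(** Under [tau k] the image of each letter contains both letters; this primitivity drives
    minimality. *)
Lemma block_infix i c c' : infix (block i c) (block i.+1 c').
Proof.
rewrite -!blocks1 blocksS; apply: infix_blocks => /=; rewrite cats0.
apply/infixP; case: c c' => -[] /=; [exists [::]|exists [:: false]|exists [:: true]|exists [::]].
all: by eexists.
Qed.

Lemma block_mono i j c : i <= j -> infix (block i c) (block j c).
Proof.
move=> /subnK <-; elim: (j - i) => [|k IH]; first exact: infix_refl.
exact: infix_trans IH (block_infix _ _ _).
Qed.

Lemma block_split i j c : i <= j -> exists w, block j c = blocks i w.
Proof.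
move=> /subnK <-; elim: (j - i) c => [|k IH] c; first by exists [:: c]; rewrite blocks1.
have : forall v, exists w, blocks (k + i) v = blocks i w.
  elim=> [|b v [w vw]]; first by exists [::].
  have [w' bw'] := IH b; exists (w' ++ w).
  by rewrite -cat1s !blocks_cat blocks1 vw bw'.
by move=> /(_ (tau (n (k + i)) c)).
Qed.

Lemma subst_word_iter_cat (f : substitution bool) k u v :
  iter k (subst_word f) (u ++ v) = iter k (subst_word f) u ++ iter k (subst_word f) v.
Proof. by elim: k => //= k ->; rewrite /subst_word map_cat flatten_cat. Qed.

Lemma iter_phi k c : iter k (subst_word phi) [:: c] =
  if c then true :: nseq k false else [:: false].
Proof.
case: c; elim: k => //= k ->; rewrite /subst_word //=; congr [:: _, _ & _].
by elim: k => //= k ->.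
Qed.

Lemma iter_phi_psi k w :
  iter k (subst_word phi) (subst_word psi w) = flatten (map (tau k) w).
Proof.
elim: w => [|c w IH]; first by elim: k => //= k ->.
rewrite -[subst_word psi (c :: w)]/([:: c] ++ ([:: ~~ c] ++ subst_word psi w)).
rewrite !subst_word_iter_cat.
rewrite IH !iter_phi catA; congr cat.
by case: c => //=; have := nseqD k 1 false; rewrite addn1 /= => ->.
Qed.

(** Lets an unfinished stage be completed: the image of a letter under phi^r already occurs in a
    full stage. *)
Lemma infix_phi_tau r k (a : bool) : r <= k ->
  infix (if a then true :: nseq r false else [:: false]) (tau k true).
Proof.
move=> rk; apply/infixP; case: a; last by exists [:: true], (nseq k false).
exists [::], (nseq (k.+1 - r) false) => /=; congr cons.
by rewrite -[false :: _]/(nseq k.+1 false) -nseqD subnKC// ltnW.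
Qed.

Lemma subst_stage k w : let: (i, r) := stage k in r <= n i /\
  foldr (fun i F => subst_word (mss_subst (mss_seq system i)) \o F) id (iota 0 k) w =
  blocks i (iter r (subst_word phi) w).
Proof.
elim: k w => [|k IH] w; first by rewrite /= blocks0.
have -> : iota 0 k.+1 = iota 0 k ++ [:: k] by rewrite -[k.+1]addn1 iotaD.
rewrite foldr_cat /=.
set G := fun i F => _.
(* The last substitution acts first, so it moves from the initial value of the fold to the word. *)
have foldrE F s v : foldr G F s v = foldr G id s (F v).
  by elim: s => //= j s IHs; rewrite /G /= -/G IHs.
rewrite foldrE /=; move: IH; case E: (stage k) => [i r] IH.
case: ifP => [/eqP rn|rn] /=.
  by split=> //; rewrite (IH _).2 rn iter_phi_psi blocksS.
split; first by have := (IH w).1; lia.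
by rewrite (IH _).2 -iterSr.
Qed.

Lemma stage_start i : exists k, stage k = (i, 0).
Proof.
elim: i => [|i [k kE]]; first by exists 0.
have h r : r <= n i -> stage (k + r) = (i, r).
  elim: r => [|r IH] rn; first by rewrite addn0.
  rewrite addnS /= IH; last by lia.
  by rewrite (_ : (r == n i) = false)//; lia.
by exists (k + n i).+1; rewrite /= h// eqxx.
Qed.

(** * The language of the system *)

Definition legal (w : seq bool) := exists i, infix w (block i false).

Lemma legalP w :
  (exists k (a : bool), infix w (@subst_between system 0 k [:: a])) <-> legal w.
Proof.
split=> [[k [a]]|[i wi]].
  have := subst_stage k.+1 [:: a]; case: (stage _) => i r [rn].
  rewrite /subst_between /index_iota subn0 => -> /infix_trans h.
  (* One level completes the unfinished stage, a second one makes the outer letter a. *)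
  exists i.+2; apply: h; apply: infix_trans (block_infix i.+1 true false).
  rewrite -blocks1 blocksS; apply: infix_blocks.
  by rewrite /= cats0 iter_phi; exact: infix_phi_tau.
(* [subst_between 0 k] has [k.+1] factors, so there must be at least one; the start of stage [i.+1]
   guarantees it. *)
have [[|k] kE] := stage_start i.+1; first by case: kE.
exists k, false; have := subst_stage k.+1 [:: false]; rewrite kE => -[_].
rewrite /subst_between /index_iota subn0 => ->.
rewrite /= -/(block i.+1 false) blocks1.
exact: infix_trans wi (block_infix i false false).
Qed.


Lemma nth_block0 i c : nth false (block i c) 0 = c.
Proof.
elim: i c => // i IH c; rewrite -blocks1 blocksS /= cats0.
rewrite -[0]/(0 * len i + 0) nth_blocks ?len_gt0 ?size_tau//.
by case: c => /=; rewrite IH.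
Qed.

Lemma window_nth (T : int -> bool) t u j : j < u.+1 ->
  nth false (window (S := system) T t u) j = T (t + j%:Z)%R.
Proof. by move=> ju; rewrite (nth_map 0) ?size_iota// nth_iota. Qed.

Lemma size_window (T : int -> bool) t u : size (window (S := system) T t u) = u.+1.
Proof. by rewrite size_map size_iota. Qed.

(** Passing to a block of level at least [i] lets the surrounding word be cut into blocks of level
    [i]. *)
Lemma hull_window (T : hull system) (t : int) (u i : nat) :
  exists j x q, [/\ i <= j, block j false = blocks i x, q + u.+1 <= size x * len i &
    forall d, d < u.+1 -> nth false (blocks i x) (q + d) = \val T (t + d%:Z)%R].
Proof.
have /legalP[j wj] := set_valP T t u.
pose J := maxn i j; have iJ : i <= J by rewrite leq_maxl.
have [x xE] := block_split false iJ.
have : infix (window (S := system) (\val T) t u) (block J false).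
  by apply: infix_trans wj _; apply: block_mono; rewrite leq_maxr.
move=> /(infix_nthP false)[q]; rewrite size_window xE size_blocks => qu E.
by exists J, x, q; split=> // d du; rewrite E// window_nth.
Qed.

Definition occurs (T : int -> bool) u (p : int) : Prop :=
  forall d, d < size u -> T (p + d%:Z)%R = nth false u d.

(** A window of length [2 * len i.+1] contains a complete block of level [i.+1], and every such
    block contains [block i false]. *)
Lemma legal_occurs (T : hull system) u : legal u -> exists p, occurs (\val T) u p.
Proof.
move=> [i /(infix_nthP false)[p pu uE]]; rewrite size_block in pu.
have {}pu : p + size u <= len i := pu.
set L := len i.+1; have L0 : 0 < L := len_gt0 _.
have [j [x [q [_ _ qx E]]]] := hull_window T 0 (L + L).-1 i.+1.
rewrite prednK ?addn_gt0 ?L0// in qx E; rewrite -/L in qx.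
set k := (q %/ L).+1.
have qL : q < k * L by rewrite ltn_ceil.
have kq : k * L <= q + L by rewrite mulSn addnC leq_add2r leq_trunc_div.
have kx : k < size x.
  by rewrite -(ltn_pmul2r L0); apply: leq_trans qx; rewrite addnA; lia.
(* [e] is the place of the first a in [tau (n i) c]. *)
pose c := nth false x k; pose e := if c then 1 else 0.
have eL : e.+1 * len i <= L by rewrite /L lenS mulnC leq_mul2l /e; case: (c); lia.
exists ((k * L - q + e * len i + p)%N%:Z)%R => d du.
rewrite -[RHS]uE//; have := E (k * L - q + e * len i + p + d).
rewrite add0r PoszD => <-; last first.
  by move: eL; rewrite mulSn; lia.
have -> : q + (k * L - q + e * len i + p + d) = k * L + (e * len i + (p + d)) by lia.
rewrite nth_blocks//; last by move: eL; rewrite mulSn -/L; lia.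
rewrite -/c -blocks1 blocksS /= cats0 nth_blocks ?size_tau; [|by rewrite /e; case: (c)|by lia].
by rewrite /e; case: (c).
Qed.

Lemma occurs_window (T1 T : int -> bool) N p :
  occurs T (window (S := system) T1 (- N%:Z)%R (N + N)) p ->
  forall j : int, (absz j <= N)%N -> T1 j = T (j + (p + N%:Z))%R.
Proof.
move=> h j jN; have := h (absz (j + N%:Z)%R); rewrite size_window.
have jE : (absz (j + N%:Z)%R)%:Z%R = (j + N%:Z)%R by lia.
have jl : (absz (j + N%:Z)%R < (N + N).+1)%N by lia.
rewrite jE window_nth ?jl// jE => /(_ isT) E.
have -> : (j + (p + N%:Z) = p + (j + N%:Z))%R by lia.
by rewrite E; congr T1; lia.
Qed.

Lemma window_legal (T : hull system) t u : legal (window (S := system) (\val T) t u).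
Proof. exact/legalP/(set_valP T t u). Qed.

(** * Recognition of block boundaries *)

Hypothesis n2 : forall i, 2 <= n i.

(** After [b] at the second place of a block, the next block would have to carry
    [b] at its third place. *)
Lemma tau_true_shift k x p : 0 < k ->
  p + k.+3 < size (flatten (map (tau k) x)) ->
  nth false (flatten (map (tau k) x)) p = true ->
  nth false (flatten (map (tau k) x)) (p + k.+3) = true -> k.+2 %| p.
Proof.
move=> k0; rewrite (size_flatten_const (size_tau k)) => px.
have := divn_eq p k.+2; have : p %% k.+2 < k.+2 by rewrite ltn_mod.
set a := p %/ _; set d := p %% _ => dk pE.
have {}px : p + k.+3 < size x * k.+2 := px.
have ax : a.+1 < size x.
  by rewrite -(ltn_pmul2r (ltn0Sn k.+1)) mulSn; move: (size x * _) (a * _) px pE; lia.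
rewrite {1}pE (nth_flatten_const _ (size_tau k)) ?(ltnW ax)// => h.
have d1 : d <= 1.
  by move: h; rewrite /tau; case: ifP => _; case: (d) => [|[|d']] //=;
    rewrite nth_nseq if_same.
have [d0|dn0] := posnP d; first by move: pE; rewrite d0 addn0 => -> _; exact: dvdn_mull.
have -> : p + k.+3 = a.+1 * k.+2 + 2 by rewrite pE; lia.
rewrite (nth_flatten_const _ (size_tau k))//.
by rewrite /tau; case: ifP => _ /=; rewrite ?nth_nseq ?if_same//; case: (k) k0.
Qed.

(** A block starts with the letter that it codes, so first letters suffice for decoding. *)
Lemma blocks_inj_nth i x v p :
  p + size v <= size x ->
  (forall d, d < size v * len i ->
    nth false (blocks i x) (p * len i + d) = nth false (blocks i v) d) ->
  forall j, j < size v -> nth false x (p + j) = nth false v j.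
Proof.
move=> px E j jv; have l0 := len_gt0 i.
have := E (j * len i + 0); rewrite addnA -mulnDl !nth_blocks//; last by lia.
by rewrite !nth_block0; apply; rewrite addn0 ltn_pmul2r.
Qed.

Definition marker i := blocks i [:: true; false].

Lemma size_marker i : size (marker i) = len i + len i.
Proof. by rewrite size_blocks mulSn mul1n. Qed.

Lemma marker_legal i : legal (marker i).
Proof.
exists i.+2; apply: infix_trans (block_infix i.+1 true false).
rewrite -blocks1 blocksS; apply: infix_blocks.
by apply/infixP; exists [::], (nseq (n i) false ++ [::]).
Qed.

(** Induction on the level. The marker of level [i.+1] begins with that of level [i], so [p] is a
    multiple [p' * len i]. Decoding then shows b at the places [p'] and [p' + (n i).+3], the second
    b being the one in a b a^n, and [tau_true_shift] applies. *)
Lemma marker_dvd i x p : p + size (marker i) <= size x * len i ->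
  (forall d, d < size (marker i) ->
     nth false (blocks i x) (p + d) = nth false (marker i) d) ->
  len i %| p.
Proof.
elim: i x p => [|i IH] x p; first by rewrite /len big_ord0 dvd1n.
rewrite !size_marker blocksS; set y := flatten _ => px E.
have sy : size y = size x * (n i).+2 by rewrite (size_flatten_const (size_tau _)).
pose v := tau (n i) true ++ tau (n i) false.
have sv : size v = (n i).+2 + (n i).+2 by rewrite size_cat !size_tau.
have mE : marker i.+1 = blocks i v by rewrite /marker blocksS /= cats0.
have l0 := len_gt0 i.
have /dvdnP[p' pE] : len i %| p.
  apply: (IH y); first by rewrite size_marker sy; move: px; rewrite lenS; nia.
  move=> d; rewrite size_marker => dl; rewrite E; last by rewrite lenS; nia.
  rewrite mE /v -[tau _ true]/([:: true; false] ++ nseq (n i) false) -!catA.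
  by rewrite blocks_cat nth_cat size_marker dl.
have yv : forall j, j < size v -> nth false y (p' + j) = nth false v j.
  apply: (@blocks_inj_nth i).
    rewrite -(leq_pmul2r l0) mulnDl -pE sy sv; move: px; rewrite lenS.
    by rewrite mulnDl -[_ * _ * len i]mulnA ![len i * _]mulnC.
  move=> d; rewrite sv -pE => dv; rewrite E ?mE//.
  by rewrite lenS -mulnDr mulnC.
rewrite lenS pE mulnC dvdn_pmul2r//; apply: (@tau_true_shift _ x).
- by have := n2 i; lia.
- rewrite -/y sy -(ltn_pmul2r l0) mulnDl -pE.
  by move: px; rewrite lenS; have := n2 i; nia.
- by rewrite -/y -[p']addn0 yv ?sv.
- rewrite -/y yv ?sv; last by lia.
  rewrite /v nth_cat size_tau.
  have -> : ((n i).+3 < (n i).+2) = false by lia.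
  by have -> : (n i).+3 - (n i).+2 = 1 by lia.
Qed.

(** One window covers both occurrences; inside a concatenation of blocks each of them starts at a
    multiple of [len i]. *)
Lemma marker_occurs_mod (T : hull system) i p q :
  occurs (\val T) (marker i) p -> occurs (\val T) (marker i) q ->
  ((len i)%:Z %| (q - p)%R)%Z.
Proof.
wlog pq : p q / (p <= q)%R => [H|] op oq.
  have [pq|/ltW qp] := lerP p q; first exact: H.
  by rewrite -opprB rpredN; exact: H.
have := len_gt0 i; set l := len i => l0.
set u := absz (q - p)%R.
have [j [x [r [_ _ rx E]]]] := hull_window T p (u + (l + l)).-1 i.
rewrite prednK in rx E; last by lia.
have h1 : l %| r.
  apply: (@marker_dvd i x); rewrite size_marker -/l; first by lia.
  by move=> d dl; rewrite E; [apply: op; rewrite size_marker|lia].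
have h2 : l %| r + u.
  apply: (@marker_dvd i x); rewrite size_marker -/l; first by lia.
  move=> d dl; rewrite -addnA E; last by lia.
  rewrite -oq ?size_marker//; congr (\val T _); rewrite PoszD.
  by rewrite /u; lia.
have : l %| u by rewrite -(dvdn_addr u h1).
by rewrite /u /dvdz.
Qed.

Lemma eigenfunction_len i : exists kappa : hull system -> int, eigenfunction (len i) kappa.
Proof.
have ex (T : hull system) : exists p, occurs (\val T) (marker i) p.
  exact/legal_occurs/marker_legal.
pose pos (T : hull system) := xget 0%R [set p | occurs (\val T) (marker i) p].
have posP T : occurs (\val T) (marker i) (pos T).
  by apply: (@xgetPex _ 0%R [set p | occurs (\val T) (marker i) p]); exact: ex.
(* The left shift lowers positions by 1, hence the sign. The choice of marker does not matter modulo
   [len i]. *)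
exists (fun T => - pos T)%R; split=> T.
  have o1 : occurs (\val T) (marker i) (pos (hull_shift 1 T) + 1)%R.
    by move=> d /(posP (hull_shift 1 T)) <-; rewrite /= /left_shift addrAC.
  have := marker_occurs_mod o1 (posP T); congr dvdz; lia.
exists (absz (pos T) + (len i + len i))%N => T' TT'.
have o1 : occurs (\val T') (marker i) (pos T).
  move=> d dl; rewrite -TT' ?(posP T)//.
  by move: dl; rewrite size_marker; lia.
have := marker_occurs_mod (posP T') o1; congr dvdz; lia.
Qed.

(** * A recurrent point *)

Definition offset i := \sum_(j < i) 2 * len j.

Lemma offsetS i : offset i.+1 = offset i + 2 * len i.
Proof. by rewrite /offset big_ord_recr. Qed.

(** [offset i] is the place of the origin in [block i false]; it moves away from both ends, so the
    nested words exhaust Z. *)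
Lemma offset_bounds i : i <= offset i /\ offset i + i < len i.
Proof.
elim: i => [|i [IH1 IH2]]; first by rewrite /offset /len !big_ord0.
have := len_gt0 i; have := n2 i; rewrite offsetS lenS; nia.
Qed.

Lemma nth_blockS i p k : p < len i -> k < n i ->
  nth false (block i.+1 false) ((k + 2) * len i + p) = nth false (block i false) p.
Proof.
move=> pl kn; rewrite -blocks1 blocksS /= cats0 nth_blocks ?size_nseq//=; last by rewrite size_nseq; lia.
by rewrite addn2 /= nth_nseq if_same.
Qed.

(** The increasing union of the words [block i false], each placed so that it is
    the copy at offset [2 * len i] in the next one. *)
Definition base_point (j : int) : bool :=
  nth false (block (absz j) false) (absz (j + (offset (absz j))%:Z)%R).

Lemma base_point_aux i k (j : int) :
  (0 <= j + (offset i)%:Z)%R -> (j + (offset i)%:Z < (len i)%:Z)%R ->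
  nth false (block (k + i) false) (absz (j + (offset (k + i))%:Z)%R) =
  nth false (block i false) (absz (j + (offset i)%:Z)%R).
Proof.
move=> j0 jl.
suff : [/\ nth false (block (k + i) false) (absz (j + (offset (k + i))%:Z)%R) =
  nth false (block i false) (absz (j + (offset i)%:Z)%R),
  (0 <= j + (offset (k + i))%:Z)%R & (j + (offset (k + i))%:Z < (len (k + i))%:Z)%R] by case.
elim: k => [//|k [IH1 IH2 IH3]]; rewrite addSn offsetS.
have ln := lenS (k + i); have := n2 (k + i) => nk; have l0 := len_gt0 (k + i).
split; [|lia|nia].
rewrite -IH1 -(@nth_blockS (k + i) _ 0); [congr nth; lia|lia|lia].
Qed.

Lemma base_pointE i (j : int) :
  (0 <= j + (offset i)%:Z)%R -> (j + (offset i)%:Z < (len i)%:Z)%R ->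
  base_point j = nth false (block i false) (absz (j + (offset i)%:Z)%R).
Proof.
move=> j0 jl; have [b1 b2] := offset_bounds (absz j).
rewrite -(base_point_aux (absz j) j0 jl) addnC /base_point.
by rewrite [RHS]base_point_aux //; lia.
Qed.

Lemma base_point_hull : (base_point : full_shift system) \in hull system.
Proof.
rewrite inE => t u; apply/legalP; pose i := absz t + u.+1.
have [b1 b2] := offset_bounds i.
exists i; apply/(infix_nthP false).
exists (absz (t + (offset i)%:Z)%R); rewrite size_window ?size_block; first by lia.
move=> d du; rewrite window_nth// (@base_pointE i); [|by lia|by lia].
by congr nth; lia.
Qed.

Definition base_hull : hull system := exist (fun T => T \in hull system) _ base_point_hull.

(** Since n >= 2, the third and fourth letters of a b a^n are both a: the copy of [block i false]
    around the origin is followed by another one. *)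
Lemma base_point_recurrent i : agree i (\val base_hull) (\val (hull_shift (len i)%:Z base_hull)).
Proof.
move=> j ji; rewrite /= /left_shift; have [b1 b2] := offset_bounds i.
have ln := lenS i; have ni := n2 i; have l0 := len_gt0 i.
rewrite (@base_pointE i j); [|by lia|by lia].
rewrite (@base_pointE i.+1); [|by rewrite offsetS; lia|by rewrite offsetS; nia].
rewrite -(@nth_blockS _ _ 1); [|by lia|by lia].
by congr nth; rewrite offsetS; lia.
Qed.

(** The radius [N] of local constancy at the base point serves as the level: shifting by [len N]
    fixes [kappa] modulo [m], yet adds [len N] to it. *)
Lemma eigenfunction_dvd m (kappa : hull system -> int) :
  eigenfunction m kappa -> exists i, m %| len i.
Proof.
move=> [ks kc]; have [N NP] := kc base_hull; exists N.
have h k : (m%:Z %| (kappa (hull_shift k%:Z base_hull) - (kappa base_hull + k%:Z))%R)%Z.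
  elim: k => [|k IH]; first by rewrite hull_shift0 addr0 subrr.
  have -> : hull_shift k.+1%:Z base_hull = hull_shift 1 (hull_shift k%:Z base_hull).
    by rewrite hull_shiftD.
  have := rpredD IH (ks (hull_shift k%:Z base_hull)); congr dvdz; lia.
have := rpredB (NP _ (@base_point_recurrent N)) (h (len N)).
by rewrite (_ : (_ - _)%R = (len N)%:Z) //; lia.
Qed.

(** * Minimality *)

Lemma hull_return (T T1 : hull system) N : exists p,
  agree N (\val T1) (\val (hull_shift p T)).
Proof.
have [p /occurs_window h] := legal_occurs T (window_legal T1 (- N%:Z)%R (N + N)).
by exists (p + N%:Z)%R => j /h.
Qed.

End System.

(** Translation by p + t1 - t carries (T, t) to (sigma^p T, t1), which is close to (T1, t1) when
    sigma^p T is close to T1. *)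
Lemma minimal_of_returns (R : realType) (S : mixed_substitution_system) :
  (forall (T T1 : hull S) N, exists p, agree N (\val T1) (\val (hull_shift p T))) ->
  minimal_tiling_space R S.
Proof.
move=> ret q O [q1 Oq1] oO; move: Oq1; rewrite -(tiling_classK q1).
move: (repr q1) => [T1 t1] Ox; rewrite -(tiling_classK q); move: (repr q) => [T t].
have /nbhs_cylinder[N [e e0 H]] : nbhs (T1, t1) (@tiling_class R S @^-1` O).
  by apply: open_nbhs_nbhs; split.
have [p pP] := ret T T1 N.
exists (tiling_class ((hull_shift p T, t1) : hull_cylinder R S)); split.
  by apply: H => //=; rewrite subrr normr0.
exists (p%:~R + \val t1 - \val t) => //; rewrite translate_class.
have -> : cylinder_flow (p%:~R + \val t1 - \val t) (T, t) =
    cylinder_flow (\val t1) (hull_shift p T, unit0 R).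
  rewrite /cylinder_flow /= add0r addrC subrK.
  have E : Num.floor (p%:~R + sval t1) = Num.floor (sval t1) + p.
    by rewrite addrC floorDrz ?intr_int// intrKfloor.
  rewrite hull_shiftD E; congr pair; apply: val_inj => /=.
  by rewrite E intrD; lra.
have /andP[t0 t11] := unit_intervalP t1; rewrite /cylinder_flow /= add0r.
(* At height 1 the floor jumps and the flow lands on (sigma^(p+1) T, 0), which is glued to (sigma^p
   T, 1). *)
move: t11; rewrite le_eqVlt => /orP[/eqP t1E|t1lt].
  apply/tiling_classP; constructor 3; split=> //=.
    by rewrite t1E floor1 subrr.
  by rewrite t1E floor1 hull_shiftD.
have f0 : Num.floor (sval t1) = 0 by apply: floor_def; rewrite t0 add0r.
congr tiling_class; congr pair; first by rewrite f0 hull_shift0.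
by apply: val_inj; rewrite /= f0 subr0.
Qed.

(** * Prescribing the prime divisors *)

Section PrimeStages.
Local Open Scope nat_scope.

(** The block length of stage [i], two more than this number, is [i] for a selected prime and 4
    otherwise. Restricting to primes above 4 keeps the default from contributing any of them. *)
Definition stage_length (P : nat -> bool) (i : nat) : nat :=
  if [&& prime i, 4 < i & P i] then i - 2 else 2.

Lemma stage_length_ge2 P i : 2 <= stage_length P i.
Proof. by rewrite /stage_length; case: ifP => // /and3P[_ ? _]; lia. Qed.

Lemma prime_dvd_len P p : prime p -> 4 < p ->
  (exists i, p %| len (stage_length P) i) <-> P p.
Proof.
move=> pp p4; split=> [[i]|Pp].
  rewrite /len Euclid_dvd_prod// big_has => /hasP[j _]; rewrite /stage_length; case: ifP.
    move=> /and3P[pj j4 Pj]; have -> : (j - 2).+2 = j by lia.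
    by rewrite dvdn_prime2// => /eqP ->.
  by move=> _ /dvdn_leq; lia.
exists p.+1; rewrite lenS /stage_length pp p4 Pp /=.
have -> : (p - 2).+2 = p by lia.
exact: dvdn_mull.
Qed.

(** These primes need not be consecutive; an injective supply of primes above 4 is enough. *)
Fixpoint large_prime (k : nat) : nat :=
  if k is j.+1 then sval (prime_above (large_prime j)) else 5.

Lemma large_primeP k : prime (large_prime k) /\ 4 < large_prime k.
Proof.
elim: k => [//|k [_ IH]] /=; case: (prime_above _) => q /= qk pq.
by split=> //; lia.
Qed.

Lemma large_prime_inj : injective large_prime.
Proof.
suff h i j : i < j -> large_prime i < large_prime j.
  move=> i j E; case: (ltngtP i j) => // /h; rewrite E ltnn//.
elim: j => // j IH; rewrite ltnS leq_eqVlt /=.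
case: (prime_above _) => q /= qk _ /orP[/eqP ->//|/IH h].
exact: ltn_trans h qk.
Qed.

End PrimeStages.

Lemma dvd_fundamental_class (R : realType) (P : nat -> bool) (m : nat) : (0 < m)%N ->
  (exists z : cech_H1 (tiling_space R (system (stage_length P))),
    z *+ m = fundamental_class R (system (stage_length P))) <->
  exists i, (m %| len (stage_length P) i)%N.
Proof.
move=> m0; rewrite divisible_fundamental_class//; split=> [[kappa]|[i /dvdnP[k lk]]].
  by apply: eigenfunction_dvd; exact: stage_length_ge2.
have [kappa [k1 k2]] := eigenfunction_len (@stage_length_ge2 P) i.
have ml : (m%:Z %| (len (stage_length P) i)%:Z)%Z by rewrite lk; exact: dvdn_mull.
exists kappa; split=> [T|T]; first exact: dvdz_trans ml (k1 T).
by have [N NP] := k2 T; exists N => T' /NP; exact: dvdz_trans.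
Qed.

(** * Divisor sets and the counting argument *)

Definition divisor_set (G : zmodType) (x : G) : set nat :=
  [set m | exists z : G, z *+ m = x].

Lemma group_iso_refl G : group_iso G G.
Proof. by exists (idfun : {additive G -> G}); exists id. Qed.

Lemma divisor_set_iso (G H : zmodType) (y : H) : group_iso G H ->
  exists x : G, divisor_set x = divisor_set y.
Proof.
move=> [f [g fK gK]]; exists (g y); apply/seteqP; split=> m [z zm].
  by exists (f z); rewrite -(raddfMn f) zm gK.
by exists (g z); apply: (can_inj fK); rewrite (raddfMn f) !gK.
Qed.

(** Cantor's diagonal argument: [Q] is evaluated at its own code. *)
Lemma uncountable_bool_seq : ~ countable [set: nat -> bool].
Proof.
move=> /countable_injP[f /in2TT fI].
pose Q (k : nat) := `[< exists2 Q' : nat -> bool, f Q' = k & ~~ Q' k >].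
have : Q (f Q) = ~~ Q (f Q).
  apply/asboolP/idP => [[Q' /fI -> //]|nQ]; by exists Q.
by case: (Q _).
Qed.

(** Isomorphic groups share their divisor sets, and a countable group has countably many, so a
    countable union over the classes covers all. *)
Lemma countable_divisor_sets (I : Type) (G : I -> zmodType) :
  (forall i, countable [set: G i]) -> countable (iso_classes G) ->
  countable [set D | exists i (x : G i), D = divisor_set x].
Proof.
move=> cG cI.
pose F (c : set I) : set (set nat) :=
  [set D | exists i (x : G i), c i /\ D = divisor_set x].
apply: (@sub_countable _ _ _ (\bigcup_(c in iso_classes G) F c)).
  apply: subset_card_le => D [i [x ->]].
  by exists [set j | group_iso (G i) (G j)]; [exists i|exists i, x; split=> //; exact: group_iso_refl].
apply: bigcup_countable => // _ [i _ <-].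
apply: (@sub_countable _ _ _ (@divisor_set (G i) @` setT)).
  apply: subset_card_le => D [j [y [ij ->]]].
  by have [x <-] := divisor_set_iso y ij; exists x.
exact: sub_countable (card_image_le _ _) (cG i).
Qed.

Theorem theorem1 (R : realType) :
  exists (I : Type) (S : I -> mixed_substitution_system),
    (forall i : I, minimal_tiling_space R (S i)) /\
    ~ countable (iso_classes (fun i : I => cech_H1 (tiling_space R (S i)))).
Proof.
exists (nat -> bool), (fun P => system (stage_length P)); split=> [P|].
  by apply: minimal_of_returns => T T1 N; exact: hull_return.
move=> /countable_divisor_sets cD; apply: uncountable_bool_seq.
(* Recovers a boolean sequence from the divisor set of e, which makes the family of these sets
   uncountable. *)
pose decode (D : set nat) (k : nat) := `[< D (large_prime k) >].
apply: sub_countable (cD _); last by move=> P; exact: countable_H1_tiling_space.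
apply: card_le_trans (card_image_le decode _); apply: subset_card_le => Q _.
(* [P] moves [Q] from indices to the primes that they enumerate. *)
pose P p := `[< exists2 k, p = large_prime k & Q k >].
exists (divisor_set (fundamental_class R (system (stage_length P)))).
  by exists P, (fundamental_class R (system (stage_length P))).
apply/funext => k; have [pk k4] := large_primeP k.
have kQ : P (large_prime k) = Q k.
  by apply/asboolP/idP => [[j /large_prime_inj -> //]|Qk]; exists k.
rewrite /decode -kQ; apply/asboolP/idP.
  by move=> /dvd_fundamental_class h; apply/(prime_dvd_len _ pk k4)/h; lia.
move=> /(prime_dvd_len _ pk k4) h; apply/dvd_fundamental_class => //.
by lia.
Qed.
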